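(* Let $K\geq2$, $P>0$, $\sigma_1^2\geq\cdots\geq\sigma_K^2>0$, and $C=\frac12\log(1+P/\sigma_1^2)$. For any rate $R$ with $0<R<C$ and any positive integer $L$, if the feedback rate satisfies $R_{\mathrm{fb}}\geq(L-1)R$, then an $L$-th order exponential decay of the probability of error in the blocklength is achievable at rate $R$ over the $K$-receiver Gaussian broadcast channel with common message and rate-limited feedback of rate $R_{\mathrm{fb}}$.
   Context: Channel: for blocklength $n$, at time $i$ the transmitter sends $X_i\in\mathbb{R}$ and Receiver $k\in\{1,\ldots,K\}$ observes $Y_{k,i}=X_i+Z_{k,i}$, where the vectors $(Z_{1,i},\ldots,Z_{K,i})$ are i.i.d. over $i$, centered Gaussian with covariance $\mathrm{diag}(\sigma_1^2,\ldots,\sigma_K^2)$. A common message $M$ uniform on $\{1,\ldots,\lfloor e^{nR}\rfloor\}$, independent of the noises, is to be decoded by all receivers. Rate-limited feedback: after each time $i$, each Receiver $k$ sends a feedback signal $V_{k,i}$ taking values in an alphabet $\mathcal{V}_{k,i}$ chosen by the designer, subject to $\sum_{i=1}^nH(V_{k,i})\leq nR_{\mathrm{fb}}$ for every $k$. Inputs are $X_i=f_i(M,V_1^{i-1},\ldots,V_K^{i-1})$, subject to the expected average block-power constraint $\frac1n\mathbb{E}[\sum_{i=1}^nX_i^2]\leq P$. Receiver $k$ decodes $\hat M^{(k)}=g_k(Y_k^n)$ with $g_k:\mathbb{R}^n\to\{1,\ldots,\lfloor e^{nR}\rfloor\}$; error probability $P_e^{(n)}=\Pr[\bigcup_{k}\{\hat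 M^{(k)}\neq M\}]$. Logarithms are natural. $L$-th order exponential decay is achievable at rate $R<C$ if there is a sequence (over $n$) of such rate-$R$ schemes whose error probabilities satisfy $\liminf_{n\to\infty}\frac1n\log\log\cdots\log(-\log P_e^{(n)})>0$, where the total number of logarithms (including the innermost one) is $L$. *)

(* Defs.v *)
From HB Require Import structures.
From mathcomp Require Import all_boot all_order all_algebra.
From mathcomp Require Import all_classical all_reals all_analysis.
Set Implicit Arguments. Unset Strict Implicit. Unset Printing Implicit Defensive.
Import Order.TTheory GRing.Theory Num.Theory.
Local Open Scope ring_scope.

(** A feedback scheme of blocklength n for the K-receiver Gaussian broadcast
    channel with common message in 'I_Mn (0-based labelling of {1,..,Mn}).
    - [enc i m v] : channel input X_i (time i = 0,..,n-1) as a function of the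
      message m and the past feedback, v k = [:: V_{k,0}; ..; V_{k,i-1}].
    - [fb k i y]  : feedback signal V_{k,i} sent by receiver k after time i,
      as a function of y = [:: Y_{k,0}; ..; Y_{k,i}] (countable alphabet nat).
    - [dec k y]   : decoder of receiver k applied to y = Y_k^n. *)
Record fb_scheme (R : realType) (K Mn : nat) := FbScheme {
  enc : nat -> 'I_Mn -> ('I_K -> seq nat) -> R ;
  fb  : 'I_K -> nat -> seq R -> nat ;
  dec : 'I_K -> seq R -> 'I_Mn }.

Section Channel.
Context {R : realType} {K Mn : nat} (S : fb_scheme R K Mn).

Fixpoint traj (m : 'I_Mn) (z : nat -> 'I_K -> R) (t : nat)
  : seq R * ('I_K -> seq R) * ('I_K -> seq nat) :=
  match t with
  | 0 => ([::], fun _ => [::], fun _ => [::])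
  | t'.+1 =>
      let: (xs, ys, vs) := traj m z t' in
      let x := enc S t' m vs in
      let ys' := fun k => rcons (ys k) (x + z t' k) in
      (rcons xs x, ys', fun k => rcons (vs k) (fb S k t' (ys' k)))
  end.

End Channel.

(** Expectation of f(W_1,..,W_N) for independent centered Gaussians W_j with
    standard deviations sds = [:: s_1; ..; s_N] (iterated integral against
    the product of the normal laws). *)
Fixpoint gauss_iter {R : realType} (sds : seq R) (f : seq R -> \bar R) : \bar R :=
  match sds with
  | [::] => f [::]
  | s :: sds' =>
      (\int[normal_prob 0 s]_x gauss_iter sds' (fun zs => f (x :: zs)))%E
  end.

Section Quantities.
Context {R : realType} {K : nat} (sig2 : 'I_K -> R) (n : nat).

(** standard deviations of the noise vector listed time-major:
    Z_{0,0},..,Z_{K-1,0}, Z_{0,1}, ... (index t*K + k) *)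
Definition noise_sds : seq R :=
  flatten (nseq n [seq Num.sqrt (sig2 k) | k <- enum 'I_K]).

Definition noise_of (zs : seq R) : nat -> 'I_K -> R :=
  fun t k => nth 0 zs (t * K + k).

Definition noiseE (f : (nat -> 'I_K -> R) -> \bar R) : \bar R :=
  gauss_iter noise_sds (fun zs => f (noise_of zs)).

Context {Mn : nat} (S : fb_scheme R K Mn).

Definition jointE (f : 'I_Mn -> (nat -> 'I_K -> R) -> \bar R) : \bar R :=
  ((Mn%:R)^-1%:E * \sum_(m < Mn) noiseE (f m))%E.

Definition error_prob : R :=
  fine (jointE (fun m z =>
    (if [exists k, dec S k ((traj S m z n).1.2 k) != m] then 1 else 0)%:E)).

Definition power_ok (P : R) : Prop :=
  (jointE (fun m z => (\sum_(x <- (traj S m z n).1.1) x ^+ 2)%:E)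
     <= (n%:R * P)%:E)%E.

Definition fb_pmf (k : 'I_K) (i : nat) (v : nat) : R :=
  fine (jointE (fun m z => ((nth 0 ((traj S m z n).2 k) i == v)%:R)%:E)).

Definition entropy (p : nat -> R) : \bar R :=
  (\sum_(v <oo) (- (p v * ln (p v)))%:E)%E.

Definition feedback_rate_ok (Rfb : R) : Prop :=
  forall k : 'I_K,
    (\sum_(i < n) entropy (fb_pmf k i) <= (n%:R * Rfb)%:E)%E.

Definition scheme_measurable : Prop :=
  (forall (k : 'I_K) (i : nat) (v : nat), (i < n)%N ->
     measurable [set y : (i.+1).-tuple R | fb S k i y = v]) /\
  (forall (k : 'I_K) (m : 'I_Mn),
     measurable [set y : n.-tuple R | dec S k y = m]).

End Quantities.

Definition num_msgs {R : realType} (r : R) (n : nat) : nat :=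
  Num.truncn (expR (n%:R * r)).

Definition iter_log {R : realType} (L : nat) (pe : R) : R :=
  iter L.-1 (@ln R) (- ln pe).

Definition Lth_order_achievable {R : realType} (K : nat) (sig2 : 'I_K -> R)
  (P Rfb r : R) (L : nat) : Prop :=
  exists S : forall n : nat, fb_scheme R K (num_msgs r n),
    (forall n, scheme_measurable n (S n) /\ power_ok sig2 n (S n) P
               /\ feedback_rate_ok sig2 n (S n) Rfb) /\
    (0 < limn_einf (fun n => ((n%:R)^-1 * iter_log L (error_prob sig2 n (S n)))%:E))%E.

(* Main.v *)
(** Phase 1 uses one code that is good for all receivers.  The codewords are chosen
    greedily, one by one and letter by letter, never exceeding the
    Gaussian random-coding mean of an exponential bound on the error of a threshold
    test on the information density; this gives error [exp(-cn)] at rates below [C].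
    Each receiver then feeds back its guess, at the price of entropy at most [nR].
    If some guess is wrong, an event of probability [e], the sender resends the
    message with power of order [1/e] over a bounded number of channel uses, and
    stays silent otherwise, so the average power is under control while the error
    drops below [exp(-e^(-1/2))]; the square root absorbs the cost of splitting the
    message into digits.  Iterating [L-1] times adds one exponential per phase.

    Error events of the scheme are only ever bounded by explicit sums of products of
    functions of single noise variables, and integrals of nonnegative functions are
    monotone and superadditive without measurability; so the measurability of the
    trajectories is never needed. *)
Require Import Defs.
From HB Require Import structures.
From mathcomp Require Import all_boot all_order all_algebra.
From mathcomp Require Import all_classical all_reals all_analysis.
From mathcomp Require Import measurable_realfun ring lra.
Set Implicit Arguments. Unset Strict Implicit. Unset Printing Implicit Defensive.
Import Order.TTheory GRing.Theory Num.Theory.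
Import numFieldNormedType.Exports.
Local Open Scope classical_set_scope.
Local Open Scope ring_scope.

(** * Gaussian expectations *)

(** Sending one of exp(nR) messages as a single amplitude takes energy of order exp(2nR), too much
    for an event of probability exp(-cn) when c < 2R. With [d] base-[B] digits the amplitudes are
    only of order exp(nR/d); a [d] independent of the blocklength makes this small against the error
    exponent, and the slots taken from the code cost constant factors only. The code is built for a
    power [P1 < P], and all resending phases together live on the slack [P - P1] of a single channel
    use. A resending phase succeeds as soon as its own noise is small, whatever was guessed before.
    So no conditioning between phases is needed: the energy of a phase is controlled by the noise of
    the phase before it, and the final error by the noise of the last phase and the rare cutoff
    event. The price of leaving trajectories unmeasured is that the probabilities of disjoint events
    are only known to sum to at most 1; the entropy bound is adapted to this. *)

Section nonneg_integral.
Context d (T : measurableType d) (R : realType) (mu : {measure set T -> \bar R}).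
Local Open Scope ereal_scope.
Import HBNNSimple.

Lemma le_integral_nonmeasurable (f g : T -> \bar R) :
  (forall x, 0 <= f x) -> (forall x, f x <= g x) ->
  \int[mu]_x f x <= \int[mu]_x g x.
Proof.
move=> f0 fg; have g0 x : 0 <= g x by exact: le_trans (fg x).
rewrite !ge0_integralTE//; apply: ereal_sup_le => _ [h hf <-].
by exists h => //= x; exact: le_trans (fg x).
Qed.

(** The integral is a supremum over simple functions from below, and simple functions below [f] and
    [g] add up to one below [f + g]. Measurability would only be needed for the reverse
    inequality. *)
Lemma superadditive_integral (f g : T -> \bar R) :
  (forall x, 0 <= f x) -> (forall x, 0 <= g x) ->
  \int[mu]_x f x + \int[mu]_x g x <= \int[mu]_x (f x + g x).
Proof.
move=> f0 g0; have fg0 x : 0 <= f x + g x by exact: adde_ge0.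
rewrite (ge0_integralTE _ f0) (ge0_integralTE _ g0) (ge0_integralTE _ fg0).
set A := [set _ | _ in _]; set B := [set _ | _ in _].
have key (h1 h2 : {nnsfun T >-> R}) : (forall x, (h1 x)%:E <= f x) -> (forall x, (h2 x)%:E <= g x) ->
    sintegral mu h1 + sintegral mu h2
    <= ereal_sup [set sintegral mu h | h in
      [set h : {nnsfun T >-> R} | forall x, (h x)%:E <= f x + g x]].
  move=> h1f h2g; rewrite -sintegralD//; apply: ereal_sup_ubound.
  exists (add_nnsfun h1 h2) => //= x.
  by rewrite EFinD; exact: leeD.
set S := ereal_sup _ in key *.
have A0 : A 0 by exists (cst_nnsfun T (0%:nng)%R) => //=; exact: sintegral0.
have B0 : B 0 by exists (cst_nnsfun T (0%:nng)%R) => //=; exact: sintegral0.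
(* Outside this trivial case [S] bounds everything in sight, so all quantities are finite and the
   two suprema can be moved across the inequality one after the other. *)
have [->|SNy] := eqVneq S +oo; first by rewrite leey.
have S0 : 0 <= S.
  by case: A0 => h1 h1f <-; case: B0 => h2 h2f; rewrite -[X in X <= _]adde0 => <-; exact: key.
have Sfin : S \is a fin_num by rewrite ge0_fin_numE// ltey.
have Ble b : B b -> b <= S.
  by move=> [h2 h2g <-]; case: A0 => h1 h1f h10; rewrite -[X in X <= _]add0e -h10; exact: key.
have supB0 : 0 <= ereal_sup B by exact: ereal_sup_ubound.
have supBfin : ereal_sup B \is a fin_num.
  rewrite ge0_fin_numE// (le_lt_trans _ (_ : S < +oo)) ?ltey//.
  exact: ge_ereal_sup.
rewrite -leeBrDr//; apply: ge_ereal_sup => a [h1 h1f <-].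
have h1fin : sintegral mu h1 \is a fin_num.
  rewrite ge0_fin_numE ?sintegral_ge0// (le_lt_trans _ (_ : S < +oo)) ?ltey//.
  by case: B0 => h2 h2g h20; rewrite -[X in X <= _]adde0 -h20; exact: key.
rewrite leeBrDr// -leeBrDl//; apply: ge_ereal_sup => b [h2 h2g <-].
by rewrite leeBrDl//; exact: key.
Qed.

End nonneg_integral.

(** * Integrals against a normal law *)

Section normal_expectation.
Context {R : realType}.
Implicit Types (m s : R).
Local Notation mu := (@lebesgue_measure R).
Import HBNNSimple.

(** Checked on simple functions, then extended by monotone convergence on both sides. *)
Lemma integral_normal_prob m s (f : measurableTypeR R -> \bar R) :
  measurable_fun setT f -> (forall x, (0 <= f x)%E) ->
  (\int[normal_prob m s]_x f x = \int[mu]_x (f x * (normal_pdf m s x)%:E))%E.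
Proof.
move=> mf f0.
have mpdf : measurable_fun setT (fun x => (normal_pdf m s x)%:E).
  by apply/measurable_EFinP; exact: measurable_normal_pdf.
pose h := nnsfun_approx measurableT mf.
have hE x : f x = limn (fun n => (h n x)%:E).
  by apply/esym/cvg_lim => //; exact: cvg_nnsfun_approx.
have simple (g : {nnsfun measurableTypeR R >-> R}) : (\int[normal_prob m s]_x (g x)%:E =
    \int[mu]_x ((g x)%:E * (normal_pdf m s x)%:E))%E.
  under [LHS]eq_integral do rewrite fimfunE -fsumEFin//.
  rewrite [LHS]ge0_integral_fsum//; last 2 first.
  - by move=> r; exact/measurable_EFinP/measurableT_comp.
  - by move=> n x _; rewrite EFinM nnfun_muleindic_ge0.
  under [RHS]eq_integral.
    move=> x xD; rewrite fimfunE -fsumEFin// ge0_mule_fsuml; last first.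
      by move=> r; rewrite EFinM nnfun_muleindic_ge0.
    over.
  rewrite [RHS]ge0_integral_fsum//; last 2 first.
  - move=> r; apply: emeasurable_funM => //.
    by apply/measurable_EFinP; exact: measurableT_comp.
  - move=> n x _; rewrite EFinM mule_ge0//; first by rewrite nnfun_muleindic_ge0.
    by rewrite lee_fin normal_pdf_ge0.
  apply: eq_fsbigr => r _; rewrite integralZl_indic_nnsfun//= integral_indic// setIT.
  have [r0|r0] := ltP r 0%R.
    rewrite preimage_nnfun0//= measure0 mule0 integral0_eq// => x _.
    by rewrite indic0 mulr0 mul0e.
  under eq_integral do rewrite EFinM -muleA.
  rewrite ge0_integralZl//=; last 2 first.
  - apply: emeasurable_funM => //.
    exact/measurable_EFinP.
  - by move=> x _; rewrite mule_ge0// lee_fin ?normal_pdf_ge0.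
  congr (_ * _)%E; rewrite [LHS]/normal_prob [LHS]integral_mkcond.
  apply: eq_integral => x _; rewrite patchE indicE.
  by case: ifP => _; rewrite ?mul1e ?mul0e.
transitivity (limn (fun n => \int[normal_prob m s]_x (h n x)%:E)%E).
  rewrite -monotone_convergence//=.
  - by apply: eq_integral => x _; exact: hE.
  - by move=> n; exact/measurable_EFinP/measurable_funTS.
  - by move=> n ? _; rewrite lee_fin.
  - by move=> ? _ ? ? mn; rewrite lee_fin; exact/lefP/nd_nnsfun_approx.
transitivity (limn (fun n => \int[mu]_x ((h n x)%:E * (normal_pdf m s x)%:E))%E).
  by apply: congr_lim; apply/funext => n; exact: simple.
rewrite -monotone_convergence//=.
- apply: eq_integral => x _; apply/cvg_lim => //.
  by apply: cvgeZr => //; exact: cvg_nnsfun_approx.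
- move=> n; apply: emeasurable_funM => //.
  exact/measurable_EFinP/measurable_funTS.
- by move=> n x _; rewrite mule_ge0// lee_fin ?normal_pdf_ge0.
- move=> x _ a b ab; rewrite lee_pmul// ?lee_fin ?normal_pdf_ge0//.
  exact/lefP/nd_nnsfun_approx.
Qed.

Lemma measurable_expR_quadratic (a b c : R) :
  measurable_fun setT (fun x : measurableTypeR R => expR (a * x ^+ 2 + b * x + c)).
Proof.
apply: measurableT_comp => //; apply: measurable_funD => //.
by apply: measurable_funD; apply: measurable_funM.
Qed.

Lemma integral_normal_expR_quadratic s (a b c : R) : 0 < s -> 2 * a * s ^+ 2 < 1 ->
  (\int[normal_prob 0 s]_x (expR (a * x ^+ 2 + b * x + c))%:E =
   ((Num.sqrt (1 - 2 * a * s ^+ 2))^-1 *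
     expR (c + b ^+ 2 * s ^+ 2 / (2 * (1 - 2 * a * s ^+ 2))))%:E)%E.
Proof.
move=> s0 as1; have w0 : 0 < 1 - 2 * a * s ^+ 2 by lra.
set w := 1 - 2 * a * s ^+ 2 in w0 *.
have s2 : s != 0 by rewrite gt_eqF.
have w2 : w != 0 by rewrite gt_eqF.
(* Completing the square: the integrand times the normal density is a constant times the normal
   density of mean [m'] and deviation [s']. *)
pose s' := s / Num.sqrt w; pose m' := b * s ^+ 2 / w.
have sw0 : 0 < Num.sqrt w by rewrite sqrtr_gt0.
have s'0 : 0 < s' by rewrite divr_gt0.
have s'2 : s' ^+ 2 = s ^+ 2 / w by rewrite expr_div_n sqr_sqrtr// ltW.
rewrite integral_normal_prob//; last first.
  by apply: measurableT_comp => //; exact: measurable_expR_quadratic.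
set k := (Num.sqrt w)^-1 * _.
have k0 : (0 <= k%:E)%E.
  by rewrite lee_fin mulr_ge0 ?expR_ge0 ?invr_ge0 ?sqrtr_ge0.
transitivity (k%:E * \int[mu]_x (normal_pdf m' s' x)%:E)%E; last first.
  by rewrite integral_normal_pdf mule1.
have mpdf : measurable_fun [set: measurableTypeR R] (fun x => (normal_pdf m' s' x)%:E).
  by apply/measurable_EFinP; exact: measurable_normal_pdf.
have pdf0 x : setT x -> (0 <= (normal_pdf m' s' x)%:E)%E.
  by rewrite lee_fin normal_pdf_ge0.
rewrite -(ge0_integralZl mu measurableT mpdf pdf0 k0).
apply: eq_integral => x _; rewrite -!EFinM; congr (_%:E); rewrite /k.
rewrite /normal_pdf !gt_eqF// /normal_fun /normal_peak s'2.
have -> : Num.sqrt (s ^+ 2 / w * pi *+ 2) = Num.sqrt (s ^+ 2 * pi *+ 2) / Num.sqrt w.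
  have -> : s ^+ 2 / w * pi *+ 2 = s ^+ 2 * pi *+ 2 / w.
    by rewrite mulrAC mulrnAl.
  have p0 : 0 <= s ^+ 2 * pi *+ 2 by rewrite mulrn_wge0// mulr_ge0 ?sqr_ge0 ?pi_ge0.
  by rewrite (sqrtrM _ p0) (sqrtrV (ltW w0)).
rewrite [LHS]mulrCA -expRD.
have p0 : Num.sqrt (s ^+ 2 * pi *+ 2) != 0.
  by rewrite gt_eqF// sqrtr_gt0 pmulrn_lgt0// mulr_gt0 ?exprn_gt0 ?pi_gt0.
rewrite [RHS](_ : _ = (Num.sqrt (s ^+ 2 * pi *+ 2))^-1 *
  (expR (c + b ^+ 2 * s ^+ 2 / (2 * w)) * expR (- (x - m') ^+ 2 / (s ^+ 2 / w *+ 2)))); last first.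
  by field; rewrite p0 gt_eqF.
rewrite -expRD; congr (_ * expR _).
rewrite /m' -[_ *+ 2]mulr_natl -[(_ / _) *+ 2]mulr_natl.
have aE : a = (1 - w) / (2 * s ^+ 2) by rewrite /w; field.
by rewrite aE; field; rewrite s2 w2.
Qed.

End normal_expectation.

(** * Means under independent Gaussians *)

Section gaussian_mean.
Context {R : realType}.
Implicit Types (sds zs : seq R).

Lemma gauss_iter_ge0 sds (f : seq R -> \bar R) :
  (forall zs, size zs = size sds -> (0 <= f zs)%E) -> (0 <= gauss_iter sds f)%E.
Proof.
elim: sds f => [|s sds ih] f f0 /=; first exact: f0.
by apply: integral_ge0 => x _; apply: ih => zs zsE; apply: f0; rewrite /= zsE.
Qed.

Lemma le_gauss_iter sds (f g : seq R -> \bar R) :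
  (forall zs, size zs = size sds -> (0 <= f zs)%E) ->
  (forall zs, size zs = size sds -> (f zs <= g zs)%E) ->
  (gauss_iter sds f <= gauss_iter sds g)%E.
Proof.
elim: sds f g => [|s sds ih] f g f0 fg /=; first exact: fg.
apply: le_integral_nonmeasurable => x.
  by apply: gauss_iter_ge0 => zs zsE; apply: f0; rewrite /= zsE.
by apply: ih => zs zsE; [apply: f0|apply: fg]; rewrite /= zsE.
Qed.

Lemma superadditive_gauss_iter sds (f g : seq R -> \bar R) :
  (forall zs, size zs = size sds -> (0 <= f zs)%E) ->
  (forall zs, size zs = size sds -> (0 <= g zs)%E) ->
  (gauss_iter sds f + gauss_iter sds g
     <= gauss_iter sds (fun zs => f zs + g zs))%E.
Proof.
elim: sds f g => [|s sds ih] f g f0 g0 //=.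
have F0 x : (0 <= gauss_iter sds (fun zs => f (x :: zs)))%E.
  by apply: gauss_iter_ge0 => zs zsE; apply: f0; rewrite /= zsE.
have G0 x : (0 <= gauss_iter sds (fun zs => g (x :: zs)))%E.
  by apply: gauss_iter_ge0 => zs zsE; apply: g0; rewrite /= zsE.
apply: le_trans (superadditive_integral (normal_prob 0 s) F0 G0) _.
apply: le_integral_nonmeasurable => x; first exact: adde_ge0.
by apply: ih => zs zsE; [apply: f0|apply: g0]; rewrite /= zsE.
Qed.

Lemma superadditive_gauss_iter_sum (I : Type) (r : seq I) sds
    (f : I -> seq R -> \bar R) :
  (forall i zs, size zs = size sds -> (0 <= f i zs)%E) ->
  (\sum_(i <- r) gauss_iter sds (f i)
     <= gauss_iter sds (fun zs => \sum_(i <- r) f i zs))%E.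
Proof.
move=> f0; elim: r => [|i r ih].
  by rewrite big_nil; apply: gauss_iter_ge0 => zs _; rewrite big_nil.
rewrite big_cons (_ : (fun _ => _) = fun zs => f i zs + \sum_(j <- r) f j zs)%E; last first.
  by apply/funext => zs; rewrite big_cons.
have S0 zs : size zs = size sds -> (0 <= \sum_(j <- r) f j zs)%E.
  by move=> zsE; apply: sume_ge0 => j _; exact: f0.
exact: le_trans (leeD2l _ ih) (superadditive_gauss_iter (f0 i) S0).
Qed.

(** [e] is the mean of [f] under independent Gaussians, and all partial integrals
    of [f] are measurable in the remaining variable; this is what makes
    [gauss_iter] additive without measurability on the space of sequences. *)
Fixpoint gauss_mean sds (f : seq R -> R) (e : R) : Prop :=
  match sds with
  | [::] => 0 <= e /\ f [::] = e
  | s :: sds' => exists g : R -> R,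
      [/\ measurable_fun [set: measurableTypeR R] g,
          forall x, gauss_mean sds' (fun zs => f (x :: zs)) (g x) &
          (\int[normal_prob 0 s]_x (g x)%:E = e%:E)%E]
  end.

Lemma gauss_mean_ge0 sds f e : gauss_mean sds f e -> 0 <= e.
Proof.
elim: sds f e => [|s sds ih] f e /= => [[]//|[g [_ gf ge]]].
by rewrite -lee_fin -ge; apply: integral_ge0 => x _; rewrite lee_fin (ih _ _ (gf x)).
Qed.

Lemma gauss_mean_iter sds f e : gauss_mean sds f e ->
  gauss_iter sds (fun zs => (f zs)%:E) = e%:E.
Proof.
elim: sds f e => [|s sds ih] f e /= => [[_ ->]//|[g [_ gf <-]]].
by apply: eq_integral => x _; exact: ih.
Qed.

Lemma eq_gauss_mean sds f g e :
  (forall zs, size zs = size sds -> f zs = g zs) ->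
  gauss_mean sds f e -> gauss_mean sds g e.
Proof.
elim: sds f g e => [|s sds ih] f g e fg /=; first by rewrite fg.
move=> [h [mh hf he]]; exists h; split => // x.
by apply: ih (hf x) => zs zsE; apply: fg; rewrite /= zsE.
Qed.

Lemma integral_normal_cst s (c : R) : (\int[normal_prob 0 s]_x c%:E = c%:E)%E.
Proof.
rewrite integral_cst//; have := probability_setT (normal_prob 0 s).
by move=> /= ->; rewrite mule1.
Qed.

Lemma gauss_mean_cst sds c : 0 <= c -> gauss_mean sds (fun=> c) c.
Proof.
move=> c0; elim: sds => [|s sds ih] //=; exists (fun=> c); split => //.
exact: integral_normal_cst.
Qed.

Lemma gauss_meanD sds f1 f2 e1 e2 : gauss_mean sds f1 e1 ->
  gauss_mean sds f2 e2 -> gauss_mean sds (fun zs => f1 zs + f2 zs) (e1 + e2).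
Proof.
elim: sds f1 f2 e1 e2 => [|s sds ih] f1 f2 e1 e2 /=.
  by move=> [? ->] [? ->]; split => //; exact: addr_ge0.
move=> [g1 [m1 h1 i1]] [g2 [m2 h2 i2]]; exists (fun x => g1 x + g2 x); split.
- exact: measurable_funD.
- by move=> x; exact: ih.
- rewrite EFinD -i1 -i2 -ge0_integralD//.
  + by move=> x _; rewrite lee_fin (gauss_mean_ge0 (h1 x)).
  + exact/measurable_EFinP.
  + by move=> x _; rewrite lee_fin (gauss_mean_ge0 (h2 x)).
  + exact/measurable_EFinP.
Qed.

Lemma gauss_meanZ sds c f e : 0 <= c -> gauss_mean sds f e ->
  gauss_mean sds (fun zs => c * f zs) (c * e).
Proof.
move=> c0; elim: sds f e => [|s sds ih] f e /=.
  by move=> [? ->]; split => //; exact: mulr_ge0.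
move=> [g [mg h i]]; exists (fun x => c * g x); split.
- exact: measurable_funM.
- by move=> x; exact: ih.
- rewrite EFinM -i -ge0_integralZl//.
  + exact/measurable_EFinP.
  + by move=> x _; rewrite lee_fin (gauss_mean_ge0 (h x)).
Qed.

Lemma gauss_mean_sum (I : eqType) (r : seq I) sds (f : I -> seq R -> R) (e : I -> R) :
  (forall i, i \in r -> gauss_mean sds (f i) (e i)) ->
  gauss_mean sds (fun zs => \sum_(i <- r) f i zs) (\sum_(i <- r) e i).
Proof.
elim: r => [|i r ih] h.
  rewrite big_nil; under eq_fun do rewrite big_nil.
  exact: gauss_mean_cst.
rewrite big_cons (_ : (fun _ => _) = fun zs => f i zs + \sum_(j <- r) f j zs); last first.
  by apply/funext => zs; rewrite big_cons.
apply: gauss_meanD; first by apply: h; rewrite mem_head.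
by apply: ih => j jr; apply: h; rewrite in_cons jr orbT.
Qed.

(** Independence, by induction: the factor of the first variable is a constant for the inner
    integrals. *)
Lemma gauss_mean_prod sds (g : nat -> R -> R) (e : nat -> R) :
  (forall i, (i < size sds)%N -> measurable_fun [set: measurableTypeR R] (g i)) ->
  (forall i x, (i < size sds)%N -> 0 <= g i x) ->
  (forall i, (i < size sds)%N ->
    (\int[normal_prob 0 (nth 0%R sds i)]_x (g i x)%:E = (e i)%:E)%E) ->
  gauss_mean sds (fun zs => \prod_(i < size sds) g i (nth 0 zs i))
    (\prod_(i < size sds) e i).
Proof.
elim: sds g e => [|s sds ih] g e mg g0 ge /=; first by rewrite !big_ord0.
have ih' := ih (fun i => g i.+1) (fun i => e i.+1)
  (fun i ilt => mg i.+1 ilt) (fun i x ilt => g0 i.+1 x ilt)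
  (fun i ilt => ge i.+1 ilt).
exists (fun x => g 0 x * \prod_(i < size sds) e i.+1); split.
- by apply: measurable_funM => //; exact: mg.
- move=> x; have := gauss_meanZ (g0 0 x isT) ih'.
  by apply: eq_gauss_mean => zs _; rewrite big_ord_recl.
- rewrite big_ord_recl EFinM -(ge 0)//= muleC -ge0_integralZl//.
  + by apply: eq_integral => x _; rewrite -EFinM mulrC.
  + by apply/measurable_EFinP; exact: mg.
  + by move=> x _; rewrite lee_fin g0.
  + by rewrite lee_fin (gauss_mean_ge0 ih').
Qed.

Lemma gauss_mean_coord sds i (g : R -> R) (e : R) :
  (i < size sds)%N -> measurable_fun [set: measurableTypeR R] g ->
  (forall x, 0 <= g x) ->
  (\int[normal_prob 0 (nth 0%R sds i)]_x (g x)%:E = e%:E)%E ->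
  gauss_mean sds (fun zs => g (nth 0 zs i)) e.
Proof.
move=> il mg g0 ge.
have := @gauss_mean_prod sds (fun j => if j == i then g else fun=> 1)
  (fun j => if j == i then e else 1).
rewrite (bigD1 (Ordinal il))//= eqxx big1 ?mulr1; last first.
  by move=> j ji; rewrite -[_ == i]/(j == Ordinal il) (negbTE ji).
move=> H; apply: eq_gauss_mean (H _ _ _).
- move=> zs _; rewrite (bigD1 (Ordinal il))//= eqxx big1 ?mulr1// => j ji.
  by rewrite -[_ == i]/(j == Ordinal il) (negbTE ji).
- by move=> j _; case: eqP.
- by move=> j x _; case: eqP.
- move=> j _; case: eqP => [->//|_].
  exact: integral_normal_cst.
Qed.

(** Otherwise [g - e] is everywhere positive with integral 0, hence vanishes almost everywhere,
    against total mass 1. *)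
Lemma exists_le_normal_mean s (g : R -> R) (e : R) :
  measurable_fun [set: measurableTypeR R] g -> (forall x, 0 <= g x) ->
  (\int[normal_prob 0 s]_x (g x)%:E = e%:E)%E -> exists x, g x <= e.
Proof.
move=> mg g0 ge; apply: contrapT => /forallNP gt.
have {}gt x : e < g x by rewrite ltNge; apply/negP/gt.
have e0 : 0 <= e by rewrite -lee_fin -ge; apply: integral_ge0 => x _; rewrite lee_fin.
have mge : measurable_fun [set: measurableTypeR R] (fun x => (g x - e)%:E).
  by apply/measurable_EFinP; exact: measurable_funB.
have : (\int[normal_prob 0 s]_x (g x - e)%:E + \int[normal_prob 0 s]_x e%:E = e%:E)%E.
  rewrite -ge0_integralD//.
  - by rewrite -[RHS]ge; apply: eq_integral => x _; rewrite -EFinD subrK.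
  - by move=> x _; rewrite lee_fin subr_ge0 ltW.
rewrite integral_normal_cst => h.
have h0 : (\int[normal_prob 0 s]_x (g x - e)%:E = 0)%E.
  move: h; case: (\int[normal_prob 0 s]_x _)%E => [r| |]//=.
  by move=> [] re; congr EFin; lra.
have := (ae_eq_integral_abs (normal_prob 0 s) measurableT mge).1.
under eq_integral do rewrite gee0_abs ?lee_fin ?subr_ge0 ?ltW//.
move=> /(_ h0) [N [mN N0 sub]].
have : (normal_prob 0 s [set: R] <= normal_prob 0 s N)%E.
  apply: le_measure; rewrite ?inE// => x _; apply: sub => /= /(_ I) [] /eqP.
  by rewrite subr_eq0 gt_eqF.
have := probability_setT (normal_prob 0 s).
by move=> /= ->; rewrite N0 leNgt lte_fin ltr01.
Qed.

(** The method of conditional expectations: coordinates are fixed one at a time, never raising the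
    mean over the remaining ones. Only one-dimensional integrals occur. *)
Lemma gauss_mean_exists sds f e : gauss_mean sds f e ->
  exists2 zs, size zs = size sds & f zs <= e.
Proof.
elim: sds f e => [|s sds ih] f e /= => [[_ <-]|[g [mg gf ge]]]; first by exists [::].
have [x xe] := exists_le_normal_mean mg (fun x => gauss_mean_ge0 (gf x)) ge.
have [zs zsE zse] := ih _ _ (gf x).
by exists (x :: zs); rewrite /= ?zsE// (le_trans zse).
Qed.

End gaussian_mean.

(** * Codes for the Gaussian channel *)

(** Codewords are chosen one at a time and consed, each against the list of those
    already chosen, so that only the mean of [B c c'] over the newer word [c']
    enters; accordingly the decoder returns the first list entry passing its test. *)
Lemma greedy_codebook {R : realType} (sds : seq R) (A Pw : seq R -> R)
    (B : seq R -> seq R -> R) (a b q Q T avg : R) (M : nat) :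
  (forall c, 0 <= A c) -> (forall c, 0 <= Pw c) -> (forall c c', 0 <= B c c') ->
  gauss_mean sds A a -> gauss_mean sds Pw q ->
  (forall c, gauss_mean sds (B c) b) ->
  0 < Q -> 0 < T -> 0 < avg -> a + M%:R * b <= avg -> q / Q + T^-1 <= 1 ->
  exists cs : seq (seq R), [/\ size cs = M,
    forall c, c \in cs -> size c = size sds /\ Pw c <= Q &
    \sum_(i < M) (A (nth [::] cs i) + \sum_(j < i) B (nth [::] cs i) (nth [::] cs j))
      <= M%:R * (T * avg)].
Proof.
move=> A0 Pw0 B0 mA mPw mB Q0 T0 avg0 leavg qQ.
have b0 : 0 <= b := gauss_mean_ge0 (mB [::]).
suff: forall m, (m <= M)%N -> exists cs : seq (seq R), [/\ size cs = m,
    forall c, c \in cs -> size c = size sds /\ Pw c <= Q &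
    \sum_(i < m) (A (nth [::] cs i) + \sum_(j < i) B (nth [::] cs i) (nth [::] cs j))
      <= m%:R * (T * avg)] by move=> /(_ M (leqnn M)).
elim=> [_|m ih mM]; first by exists [::]; split=> //; rewrite big_ord0 mul0r.
have [cs [szcs cspw cserr]] := ih (ltnW mM).
have Tavg0 : 0 < T * avg by exact: mulr_gt0.
(* Markov's inequality for power and error at once: the weighted sum has mean at most
   [q / Q + T^-1], hence at most 1, so one word keeps each of its two nonnegative parts at most
   1. *)
have mF : gauss_mean sds
    (fun c => Q^-1 * Pw c + (T * avg)^-1 * (A c + \sum_(c' <- cs) B c' c))
    (Q^-1 * q + (T * avg)^-1 * (a + \sum_(c' <- cs) b)).
  apply: gauss_meanD; first by apply: gauss_meanZ => //; rewrite invr_ge0 ltW.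
  apply: gauss_meanZ; first by rewrite invr_ge0 ltW.
  by apply: gauss_meanD => //; apply: gauss_mean_sum => c' _.
have [c szc cF] := gauss_mean_exists mF.
have {}cF : Q^-1 * Pw c + (T * avg)^-1 * (A c + \sum_(c' <- cs) B c' c) <= 1.
  apply: le_trans cF _; apply: le_trans qQ; rewrite mulrC lerD2l.
  rewrite big_const_seq count_predT iter_addr_0 szcs invfM -mulrA.
  apply: ler_piMr; first by rewrite invr_ge0 ltW.
  rewrite ler_pdivrMl// mulr1; apply: le_trans leavg; rewrite lerD2l.
  by rewrite -[b *+ m]mulr_natl ler_wpM2r// ler_nat ltnW.
have S0 : 0 <= \sum_(c' <- cs) B c' c by apply: sumr_ge0.
exists (c :: cs); split; first by rewrite /= szcs.
  move=> c'; rewrite inE => /predU1P[->|]; last exact: cspw.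
  split=> //; rewrite -[Q]mulr1 -ler_pdivrMl//; apply: le_trans cF.
  by rewrite lerDl mulr_ge0 ?invr_ge0 ?(ltW Tavg0)// addr_ge0.
have {}cF : A c + \sum_(c' <- cs) B c' c <= T * avg.
  rewrite -[T * avg]mulr1 -ler_pdivrMl//; apply: le_trans cF.
  by rewrite lerDr mulr_ge0// invr_ge0 ltW.
(* The new word takes index 0 and has no predecessor; every older word [c'] gains exactly the term
   [B c' c]. *)
rewrite big_ord_recl/= big_ord0 addr0.
under eq_bigr do rewrite big_ord_recl/= addrCA.
rewrite big_split/= addrA mulrS mulrDl mul1r; apply: lerD => //.
by move: cF; rewrite (big_nth [::]) big_mkord szcs.
Qed.

(** * Exponential moments of the information density in one channel use *)

Section single_letter.
Context {R : realType}.
Variables (p v : R).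
Hypotheses (p0 : 0 < p) (v0 : 0 < v).

Definition awgn_capacity := 2^-1 * ln (1 + p / v).

(** [ln (dN(x, v) / dN(0, p + v))] at [y]. *)
Definition info_density (x y : R) :=
  awgn_capacity + y ^+ 2 / (2 * (p + v)) - (y - x) ^+ 2 / (2 * v).

(** The squared correlation between a Gaussian input and its output. *)
Let a := p / (p + v).

(** [under_mean] and [over_mean] are averages over the noise of an exponential of the information
    density, kept in closed form so that measurability in the input letters is plain. *)
Definition under_mean (s x : R) :=
  (Num.sqrt (1 - s * a))^-1 * expR (- s * awgn_capacity - s * x ^+ 2 / (2 * (p + v))
    + (s * x / (p + v)) ^+ 2 * v / (2 * (1 - s * a))).

Definition over_mean (x x' : R) :=
  (Num.sqrt (1 + a))^-1 * expR (awgn_capacity + x ^+ 2 / (2 * (p + v))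
    - (x - x') ^+ 2 / (2 * v)
    + (x / (p + v) - (x - x') / v) ^+ 2 * v / (2 * (1 + a))).

Let pv0 : 0 < p + v. Proof. exact: addr_gt0. Qed.
Let a0 : 0 < a. Proof. exact: divr_gt0. Qed.
Let a1 : a < 1. Proof. by rewrite ltr_pdivrMr// mul1r ltrDl. Qed.
Let sqrtv : Num.sqrt v ^+ 2 = v. Proof. by rewrite sqr_sqrtr// ltW. Qed.
Let sqrtp : Num.sqrt p ^+ 2 = p. Proof. by rewrite sqr_sqrtr// ltW. Qed.

Lemma expR_half_ln (u : R) : 0 < u -> expR (2^-1 * ln u) = Num.sqrt u.
Proof.
move=> u0; rewrite -[LHS]ger0_norm ?expR_ge0// -sqrtr_sqr expr2 -expRD.
by rewrite -mulrDl (_ : 2^-1 + 2^-1 = 1 :> R) ?mul1r ?lnK//; field.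
Qed.

Lemma integral_expRN_info_density s x : 0 <= s -> s <= 1 ->
  (\int[normal_prob 0 (Num.sqrt v)]_z (expR (- s * info_density x (x + z)))%:E
   = (under_mean s x)%:E)%E.
Proof.
move=> s0 s1.
have sa1 : s * a < 1 by rewrite (le_lt_trans _ a1)// ler_piMl// ltW.
under eq_integral => z _.
  rewrite [X in expR X](_ : _ = (s / (2 * v) - s / (2 * (p + v))) * z ^+ 2
    + (- (s * x / (p + v))) * z + (- s * awgn_capacity - s * x ^+ 2 / (2 * (p + v)))).
    over.
  by rewrite /info_density; field; rewrite !gt_eqF.
have wE : 1 - 2 * (s / (2 * v) - s / (2 * (p + v))) * v = 1 - s * a.
  by rewrite /a; field; rewrite !gt_eqF.
rewrite integral_normal_expR_quadratic ?sqrtr_gt0 ?sqrtv ?wE//; last first.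
  by rewrite -subr_gt0 wE subr_gt0.
by rewrite sqrrN.
Qed.

(** Centred at [awgn_capacity], the information density is half the difference of the squares of two
    unit Gaussians with squared correlation [1 - a]. Its Laplace transform is even in [s], so the
    loss against exp(-s C) is only of second order. *)
Lemma integral_under_mean s : 0 <= s -> s <= 1 ->
  (\int[normal_prob 0 (Num.sqrt p)]_x (under_mean s x)%:E
   = (expR (- s * awgn_capacity) * (Num.sqrt (1 - s ^+ 2 * a))^-1)%:E)%E.
Proof.
move=> s0 s1.
have sa1 : 0 < 1 - s * a.
  by rewrite subr_gt0 (le_lt_trans _ a1)// ler_piMl// ltW.
have ssa1 : 0 < 1 - s ^+ 2 * a.
  rewrite subr_gt0 (le_lt_trans _ a1)//; apply: ler_piMl; first exact: ltW.
  exact: exprn_ile1.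
have rt0 : 0 < Num.sqrt (1 - s * a) by rewrite sqrtr_gt0.
pose al := - (s / (2 * (p + v))) + s ^+ 2 / (p + v) ^+ 2 * v / (2 * (1 - s * a)).
have wE : 1 - 2 * al * p = (1 - s ^+ 2 * a) / (1 - s * a).
  have sp : 0 < p + v - s * p.
    have : 0 <= p * (1 - s) by rewrite mulr_ge0 ?subr_ge0// ltW.
    by move: v0; rewrite mulrBr mulr1 mulrC; lra.
  by rewrite /al /a; field; rewrite !gt_eqF.
under eq_integral => x _.
  rewrite [X in (_ * expR X)%:E](_ : _ = al * x ^+ 2 + 0 * x + (- s * awgn_capacity)).
    rewrite EFinM; over.
  by rewrite /al; field; rewrite !gt_eqF.
rewrite ge0_integralZl//; last first.
  by apply: measurableT_comp => //; exact: measurable_expR_quadratic.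
rewrite integral_normal_expR_quadratic ?sqrtr_gt0 ?sqrtp ?wE//; last first.
  by rewrite -subr_gt0 wE divr_gt0.
rewrite expr0n/= !mul0r addr0 -EFinM; congr EFin.
rewrite (sqrtrM _ (ltW ssa1)) (sqrtrV (ltW sa1)).
by field; rewrite !gt_eqF// sqrtr_gt0.
Qed.

Lemma integral_expR_info_density x x' :
  (\int[normal_prob 0 (Num.sqrt v)]_z (expR (info_density x' (x + z)))%:E
   = (over_mean x x')%:E)%E.
Proof.
under eq_integral => z _.
  rewrite [X in expR X](_ : _ = (- (2 * v)^-1 + (2 * (p + v))^-1) * z ^+ 2
    + (x / (p + v) - (x - x') / v) * z
    + (awgn_capacity + x ^+ 2 / (2 * (p + v)) - (x - x') ^+ 2 / (2 * v))).
    over.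
  by rewrite /info_density; field; rewrite !gt_eqF.
have wE : 1 - 2 * (- (2 * v)^-1 + (2 * (p + v))^-1) * v = 1 + a.
  by rewrite /a; field; rewrite !gt_eqF.
rewrite integral_normal_expR_quadratic ?sqrtr_gt0 ?sqrtv ?wE//.
by rewrite -subr_gt0 wE addr_gt0.
Qed.

(** For a fixed output, exp of the information density is a likelihood ratio, whose average over the
    independent input [x'] is 1. Here the noise is integrated first, so the value is recovered by a
    second Gaussian integral. *)
Lemma integral_over_mean x :
  (\int[normal_prob 0 (Num.sqrt p)]_x' (over_mean x x')%:E = 1)%E.
Proof.
have a10 : 0 < 1 + a by rewrite addr_gt0.
have aB0 : 0 < 1 - a by rewrite subr_gt0.
have aX0 : 0 < 1 - a ^+ 2 by rewrite subr_gt0 exprn_ilt1// ltW.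
have rt0 : 0 < Num.sqrt (1 + a) by rewrite sqrtr_gt0.
pose al := - (2 * v)^-1 + (2 * v * (1 + a))^-1.
pose be := x / v + (x / (p + v) - x / v) / (1 + a).
pose ga := awgn_capacity + x ^+ 2 / (2 * (p + v)) - x ^+ 2 / (2 * v)
  + (x / (p + v) - x / v) ^+ 2 * v / (2 * (1 + a)).
have pvp : 0 < p + v + p by rewrite addr_gt0.
have pv2 : 0 < (p + v) ^+ 2 - p ^+ 2.
  by rewrite (_ : _ - _ = v * (p + v + p)) ?mulr_gt0//; ring.
have wE : 1 - 2 * al * p = (1 - a ^+ 2)^-1.
  by rewrite /al /a; field; rewrite !gt_eqF.
under eq_integral => x' _.
  rewrite [X in (_ * expR X)%:E](_ : _ = al * x' ^+ 2 + be * x' + ga).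
    rewrite EFinM; over.
  by rewrite /al /be /ga; field; rewrite !gt_eqF.
rewrite ge0_integralZl//; last first.
  by apply: measurableT_comp => //; exact: measurable_expR_quadratic.
rewrite integral_normal_expR_quadratic ?sqrtr_gt0 ?sqrtp ?wE//; last first.
  by rewrite -subr_gt0 wE invr_gt0.
have -> : ga + be ^+ 2 * p / (2 / (1 - a ^+ 2)) = awgn_capacity.
  by rewrite /ga /be /a; field; rewrite !gt_eqF.
have -> : expR awgn_capacity = (Num.sqrt (1 - a))^-1.
  rewrite /awgn_capacity expR_half_ln; last by rewrite addr_gt0// divr_gt0.
  rewrite -(sqrtrV (ltW aB0)); congr Num.sqrt.
  by rewrite /a; field; rewrite (addrAC p) subrr add0r !gt_eqF.
rewrite (sqrtrV (ltW aX0)) invrK -EFinM; congr EFin.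
have -> : 1 - a ^+ 2 = (1 - a) * (1 + a) by ring.
by rewrite (sqrtrM _ (ltW aB0)); field; rewrite !gt_eqF// sqrtr_gt0.
Qed.

End single_letter.

(** * Codebooks from exponential bounds *)

Section random_coding.
Context {R : realType}.
Implicit Types (p v s thr : R) (cs : seq (seq R)).

Lemma expRN_le_inv (u : R) : 0 <= u -> expR (- u) <= (1 + u)^-1.
Proof.
by move=> u0; rewrite expRN lef_pV2 ?posrE ?expR_gt0 ?expR_ge1Dx// ltr_wpDr.
Qed.

Lemma power_chernoff p P1 : 0 < p -> p < P1 ->
  exists lam rho : R, [/\ 0 < lam, 2 * lam * p < 1, 0 < rho, rho < 1 &
    (Num.sqrt (1 - 2 * lam * p))^-1 <= rho * expR (lam * P1)].
Proof.
move=> p0 pP; have P0 : 0 < P1 by exact: lt_trans pP.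
(* Half of the optimal Chernoff parameter. It maximises (1 + 2 lam P1)(1 - 2 lam p), which must
   exceed 1 once the exponential is replaced by 1 + 2 lam P1. *)
pose lam := (P1 - p) / (4 * p * P1).
have lam0 : 0 < lam by rewrite divr_gt0 ?subr_gt0// !mulr_gt0.
have lamp : 2 * lam * p = 2^-1 - p / (2 * P1).
  by rewrite /lam; field; rewrite !gt_eqF.
have pP1 : 0 < p / (2 * P1) by rewrite divr_gt0// mulr_gt0.
have w1 : 2 * lam * p < 1 by rewrite lamp; lra.
have w0 : 0 < 1 - 2 * lam * p by rewrite subr_gt0.
have rt0 : 0 < Num.sqrt (1 - 2 * lam * p) by rewrite sqrtr_gt0.
have l0 : 0 < 2 * lam * P1 by do 2 apply: mulr_gt0 => //.
exists lam, ((Num.sqrt (1 - 2 * lam * p))^-1 * expR (- (lam * P1))); split => //.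
- by rewrite mulr_gt0 ?expR_gt0// invr_gt0.
- rewrite -ltr_pdivlMl ?invr_gt0// invrK mulr1.
  rewrite -[ltLHS]ger0_norm ?expR_ge0// -sqrtr_sqr ltr_sqrt// -expRM_natl.
  apply: (@le_lt_trans _ _ (1 + 2 * lam * P1)^-1).
    rewrite (_ : 2 * - (lam * P1) = - (2 * lam * P1)); last by ring.
    exact: expRN_le_inv (ltW l0).
  have l1 : 0 < 1 + 2 * lam * P1 by rewrite addr_gt0.
  rewrite -[ltLHS]mul1r ltr_pdivrMr//.
  rewrite -subr_gt0 (_ : _ - 1 = (P1 - p) ^+ 2 / (4 * p * P1)).
    by rewrite divr_gt0 ?exprn_gt0 ?subr_gt0// !mulr_gt0.
  by rewrite /lam; field; rewrite !gt_eqF.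
- by rewrite -(mulrA _ (expR _)) -expRD addNr expR0 mulr1.
Qed.

(** Chernoff bounds for the threshold test: parameter [s] for the sent word failing it, parameter 1
    for a word earlier in the list passing it. Both are products of functions of single noise
    variables. *)
Definition awgn_err_bound p v s thr (n1 : nat) cs (i : nat) (z : nat -> R) :=
  expR (s * (n1%:R * thr)) *
    \prod_(t < n1) expR (- s * info_density p v (nth 0 (nth [::] cs i) t)
                                  (nth 0 (nth [::] cs i) t + z t))
  + \sum_(j < i) expR (- (n1%:R * thr)) *
    \prod_(t < n1) expR (info_density p v (nth 0 (nth [::] cs j) t)
                            (nth 0 (nth [::] cs i) t + z t)).

Definition awgn_err_mean p v s thr (n1 : nat) cs (i : nat) :=
  expR (s * (n1%:R * thr)) *
    \prod_(t < n1) under_mean p v s (nth 0 (nth [::] cs i) t)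
  + \sum_(j < i) expR (- (n1%:R * thr)) *
    \prod_(t < n1) over_mean p v (nth 0 (nth [::] cs i) t) (nth 0 (nth [::] cs j) t).

Lemma under_mean_ge0 p v s x : 0 <= under_mean p v s x.
Proof. by rewrite mulr_ge0 ?expR_ge0// invr_ge0 sqrtr_ge0. Qed.

Lemma over_mean_ge0 p v x x' : 0 <= over_mean p v x x'.
Proof. by rewrite mulr_ge0 ?expR_ge0// invr_ge0 sqrtr_ge0. Qed.

Lemma measurable_under_mean p v s :
  measurable_fun [set: measurableTypeR R] (under_mean p v s).
Proof.
apply: measurable_funM => //; apply: measurableT_comp => //.
apply: measurable_funD; first apply: measurable_funB => //.
  by apply: measurable_funM => //; apply: measurable_funM.
apply: measurable_funM => //; apply: measurable_funM => //.
by apply: measurable_funX; apply: measurable_funM.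
Qed.

Lemma measurable_over_mean p v x :
  measurable_fun [set: measurableTypeR R] (over_mean p v x).
Proof.
apply: measurable_funM => //; apply: measurableT_comp => //.
apply: measurable_funD; first apply: measurable_funB => //.
  by apply: measurable_funM => //; apply: measurable_funX; exact: measurable_funB.
apply: measurable_funM => //; apply: measurable_funM => //.
apply: measurable_funX; apply: measurable_funB => //.
by apply: measurable_funM => //; exact: measurable_funB.
Qed.

(** With u = s^2 p / (p + v) at most 1/2, 1 / (1 - u) <= 1 + 2u <= exp(2u). *)
Lemma under_mean_input_le p v s Cmin : 0 < p -> 0 < v -> 0 <= s -> s <= 2^-1 ->
  Cmin <= awgn_capacity p v ->
  expR (- s * awgn_capacity p v) * (Num.sqrt (1 - s ^+ 2 * (p / (p + v))))^-1
    <= expR (- s * Cmin + s ^+ 2).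
Proof.
move=> p0 v0 s0 s2 CC; rewrite expRD; apply: ler_pM => //.
- by rewrite ler_expR !mulNr lerN2 ler_wpM2l.
have pv0 : 0 < p + v by exact: addr_gt0.
pose u := s ^+ 2 * (p / (p + v)).
have a1 : p / (p + v) <= 1 by rewrite ler_pdivrMr// mul1r lerDl ltW.
have us : u <= s ^+ 2 by rewrite ler_piMr ?sqr_ge0.
have u0 : 0 <= u by rewrite mulr_ge0 ?sqr_ge0// divr_ge0// ltW.
have ss : s ^+ 2 <= 2^-1 by rewrite expr2; nra.
have w0 : 0 < 1 - u by lra.
rewrite -/u -[leRHS]invrK -expRN lef_pV2 ?posrE ?expR_gt0 ?sqrtr_gt0//.
rewrite -[leLHS]ger0_norm ?expR_ge0// -sqrtr_sqr.
rewrite (ler_sqrt _ (ltW w0)) -expRM_natl.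
apply: (@le_trans _ _ (1 + 2 * u)^-1).
  apply: le_trans (expRN_le_inv (u := 2 * u) _); last by lra.
  by rewrite ler_expR; lra.
have l0 : 0 < 1 + 2 * u by lra.
by rewrite -[leLHS]mul1r ler_pdivrMr//; nra.
Qed.

(** Adding up the errors of all receivers before the greedy choice is what makes one code serve them
    all. Letters of variance [p < P1] meet the power constraint with probability bounded away from
    0, which costs only the factor [T]. *)
Lemma awgn_codebooks (K : nat) (v : 'I_K -> R) (p P1 thr Cmin : R) :
  (0 < K)%N -> 0 < p -> p < P1 -> (forall k, 0 < v k) -> thr < Cmin ->
  (forall k, Cmin <= awgn_capacity p (v k)) ->
  exists s T c : R, [/\ 0 <= s <= 1, 0 < T, 0 < c &
  forall n1 M, (0 < n1)%N -> exists cs, [/\ size cs = M,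
    forall x, x \in cs -> size x = n1 /\ \sum_(t < n1) nth 0 x t ^+ 2 <= n1%:R * P1 &
    \sum_(i < M) \sum_(k < K) awgn_err_mean p (v k) s thr n1 cs i
      <= M%:R * (T * (expR (- (n1%:R * c)) + M%:R * expR (- (n1%:R * thr))))]].
Proof.
move=> K0 p0 pP v0 thrC CC.
have [lam [rho [lam0 lamp rho0 rho1 chern]]] := power_chernoff p0 pP.
(* The second value maximises the exponent [s * (Cmin - thr) - s ^+ 2]; the first is the limit set
   by [under_mean_input_le]. *)
pose s := Num.min 2^-1 ((Cmin - thr) / 2).
have s0 : 0 < s by rewrite lt_min invr_gt0 ltr0n divr_gt0// subr_gt0.
have s1 : s <= 2^-1 by rewrite ge_min lexx.
have sC : s <= (Cmin - thr) / 2 by rewrite ge_min lexx orbT.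
have s1' : s <= 1 by lra.
pose c := s * (Cmin - thr) - s ^+ 2.
have c0 : 0 < c by rewrite /c expr2; nra.
have KR0 : 0 < K%:R :> R by rewrite ltr0n.
(* Violating the power constraint uses up at most [rho] of the unit budget in [greedy_codebook];
   [T^-1] is the rest. *)
pose T := (1 - rho)^-1.
have T0 : 0 < T by rewrite invr_gt0 subr_gt0.
exists s, (K%:R * T), c; split => //; [by rewrite ltW|exact: mulr_gt0|].
move=> n1 M n10.
pose sds := nseq n1 (Num.sqrt p).
have szsds : size sds = n1 by rewrite size_nseq.
pose A x := \sum_(k < K) expR (s * (n1%:R * thr)) *
  \prod_(t < n1) under_mean p (v k) s (nth 0 x t).
pose B x x' := \sum_(k < K) expR (- (n1%:R * thr)) *
  \prod_(t < n1) over_mean p (v k) (nth 0 x t) (nth 0 x' t).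
pose Pw x := \prod_(t < n1) expR (lam * nth 0 x t ^+ 2 + 0 * nth 0 x t + 0).
pose a := \sum_(k < K) expR (s * (n1%:R * thr)) * \prod_(t < n1)
  (expR (- s * awgn_capacity p (v k)) * (Num.sqrt (1 - s ^+ 2 * (p / (p + v k))))^-1).
pose b := \sum_(k < K) expR (- (n1%:R * thr)) * \prod_(t < n1) (1 : R).
pose w := (Num.sqrt (1 - 2 * lam * p))^-1.
have a0 : 0 <= a.
  apply: sumr_ge0 => k _; by rewrite mulr_ge0 ?prodr_ge0.
have bE : b = K%:R * expR (- (n1%:R * thr)).
  rewrite /b; under eq_bigr do rewrite big1 ?mulr1//.
  by rewrite sumr_const card_ord -[LHS]mulr_natl.
have aE : a <= K%:R * expR (- (n1%:R * c)).
  have -> : K%:R * expR (- (n1%:R * c)) = \sum_(k < K) expR (- (n1%:R * c)).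
    by rewrite sumr_const card_ord -[RHS]mulr_natl.
  apply: ler_sum => k _.
  rewrite prodr_const card_ord.
  apply: (@le_trans _ _ (expR (s * (n1%:R * thr)) * expR (- s * Cmin + s ^+ 2) ^+ n1)).
    rewrite ler_wpM2l ?expR_ge0// lerXn2r ?nnegrE ?expR_ge0//.
    by apply: under_mean_input_le => //; exact: ltW.
  by rewrite -expRM_natl -expRD ler_expR /c; lra.
pose avg := K%:R * expR (- (n1%:R * c)) + M%:R * b.
have avg0 : 0 < avg.
  rewrite /avg bE; apply: ltr_wpDr; last by rewrite mulr_gt0 ?expR_gt0.
  by rewrite !mulr_ge0.
have [cs [szcs cspw cserr]] : exists cs : seq (seq R), [/\ size cs = M,
    forall x, x \in cs -> size x = size sds /\ Pw x <= expR (n1%:R * (lam * P1)) &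
    \sum_(i < M) (A (nth [::] cs i) + \sum_(j < i) B (nth [::] cs i) (nth [::] cs j))
      <= M%:R * (T * avg)].
  have sdsE i : (i < size sds)%N -> nth 0 sds i = Num.sqrt p.
    by rewrite szsds => ilt; rewrite nth_nseq ilt.
  apply: (@greedy_codebook R sds A Pw B a b (w ^+ n1)).
  - by move=> x; apply: sumr_ge0 => k _; rewrite mulr_ge0 ?prodr_ge0// => t _; exact: under_mean_ge0.
  - by move=> x; apply: prodr_ge0 => t _; exact: expR_ge0.
  - by move=> x x'; apply: sumr_ge0 => k _; rewrite mulr_ge0 ?prodr_ge0// => t _; exact: over_mean_ge0.
  - apply: gauss_mean_sum => k _; apply: gauss_meanZ; first exact: expR_ge0.
    rewrite -szsds; apply: (@gauss_mean_prod _ sds (fun=> under_mean p (v k) s)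
      (fun=> expR (- s * awgn_capacity p (v k)) * (Num.sqrt (1 - s ^+ 2 * (p / (p + v k))))^-1)).
    + by move=> *; exact: measurable_under_mean.
    + by move=> *; exact: under_mean_ge0.
    + by move=> i ilt; rewrite sdsE// integral_under_mean// ltW.
  - have -> : w ^+ n1 = \prod_(t < n1) w by rewrite prodr_const card_ord.
    rewrite /Pw -szsds; apply: (@gauss_mean_prod _ sds
      (fun=> fun x => expR (lam * x ^+ 2 + 0 * x + 0)) (fun=> w)).
    + by move=> *; exact: measurable_expR_quadratic.
    + by move=> *; exact: expR_ge0.
    + move=> i ilt; rewrite sdsE// integral_normal_expR_quadratic ?sqrtr_gt0//.
      * by rewrite expr0n/= !mul0r addr0 expR0 mulr1 sqr_sqrtr// ltW.
      * by rewrite sqr_sqrtr// ltW.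
  - move=> x; apply: gauss_mean_sum => k _; apply: gauss_meanZ; first exact: expR_ge0.
    rewrite -szsds; apply: (@gauss_mean_prod _ sds
      (fun t x' => over_mean p (v k) (nth 0 x t) x') (fun=> 1)).
    + by move=> *; exact: measurable_over_mean.
    + by move=> *; exact: over_mean_ge0.
    + by move=> i ilt; rewrite sdsE// integral_over_mean.
  - exact: expR_gt0.
  - exact: T0.
  - exact: avg0.
  - by rewrite lerD2r.
  - rewrite invrK -[leRHS](subrK rho) addrC lerD2l.
    apply: (@le_trans _ _ (rho ^+ n1)); last exact: ler_iXnr (ltW rho0) (ltW rho1).
    rewrite ler_pdivrMr ?expR_gt0// expRM_natl -exprMn; apply: lerXn2r => //.
      by rewrite nnegrE invr_ge0 sqrtr_ge0.
    by rewrite nnegrE mulr_ge0 ?expR_ge0// ltW.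
exists cs; split => // [x xcs|].
  have [-> Pwx] := cspw _ xcs; split; first by rewrite szsds.
  move: Pwx; rewrite /Pw -expR_sum ler_expR.
  under eq_bigr do rewrite mul0r !addr0.
  by rewrite -mulr_sumr mulrCA ler_pM2l.
have -> : \sum_(i < M) \sum_(k < K) awgn_err_mean p (v k) s thr n1 cs i =
  \sum_(i < M) (A (nth [::] cs i) + \sum_(j < i) B (nth [::] cs i) (nth [::] cs j)).
  by apply: eq_bigr => i _; rewrite big_split/= exchange_big.
by rewrite (_ : K%:R * T * _ = T * avg)// /avg bE; ring.
Qed.

End random_coding.

(** * Noise of the broadcast channel *)

Lemma big_blocks (T : Type) (idx : T) (op : Monoid.law idx) (n d : nat) (F : nat -> T) :
  \big[op/idx]_(i < n * d) F i = \big[op/idx]_(l < n) \big[op/idx]_(j < d) F (l * d + j)%N.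
Proof.
elim: n => [|n ih]; first by rewrite mul0n !big_ord0.
rewrite big_ord_recr/= -ih -!(big_mkord xpredT F) mulSnr.
rewrite (big_cat_nat _ (n := n * d))//= ?leq_addr//; congr (op _ _).
rewrite -{1}[(n * d)%N]add0n big_addn addKn big_mkord.
by apply: eq_bigr => j _; rewrite addnC.
Qed.

Section noise.
Context {R : realType} {K : nat} (sig2 : 'I_K -> R) (n : nat).

Lemma size_noise_sds : size (noise_sds sig2 n) = (n * K)%N.
Proof.
rewrite /noise_sds size_flatten /shape map_nseq size_map size_enum_ord sumn_nseq.
by rewrite mulnC.
Qed.

Lemma noise_index_lt t (k : 'I_K) : (t < n)%N -> (t * K + k < n * K)%N.
Proof.
move=> tn; apply: (@leq_trans (t.+1 * K)); last by rewrite leq_mul2r tn orbT.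
by rewrite mulSnr ltn_add2l.
Qed.

Lemma nth_noise_sds t (k : 'I_K) : (t < n)%N ->
  nth 0 (noise_sds sig2 n) (t * K + k) = Num.sqrt (sig2 k).
Proof.
rewrite /noise_sds; elim: n t => // m ih [|t] tm /=.
  rewrite mul0n add0n nth_cat size_map size_enum_ord ltn_ord.
  by rewrite (nth_map k) ?size_enum_ord// nth_ord_enum.
rewrite nth_cat size_map size_enum_ord mulSn -addnA ltnNge leq_addr/= addKn.
exact: ih.
Qed.

Definition noise_mean (f : (nat -> 'I_K -> R) -> R) (e : R) :=
  gauss_mean (noise_sds sig2 n) (fun zs => f (noise_of zs)) e.

Lemma noiseE_mean f e : noise_mean f e -> noiseE sig2 n (fun z => (f z)%:E) = e%:E.
Proof. by move=> /gauss_mean_iter. Qed.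

Lemma noise_mean_prod (q : nat) (k : 'I_K) (g : nat -> R -> R) (e : nat -> R) :
  (q <= n)%N ->
  (forall t, (t < q)%N -> measurable_fun [set: measurableTypeR R] (g t)) ->
  (forall t x, (t < q)%N -> 0 <= g t x) ->
  (forall t, (t < q)%N ->
    (\int[normal_prob 0 (Num.sqrt (sig2 k))]_x (g t x)%:E = (e t)%:E)%E) ->
  noise_mean (fun z => \prod_(t < q) g t (z t k)) (\prod_(t < q) e t).
Proof.
move=> qn mg g0 ge; have K0 : (0 < K)%N by exact: leq_ltn_trans (leq0n k) (ltn_ord k).
(* In the time-major list of all noises, every other coordinate gets the factor 1. *)
pose at_k i := (i %% K == k)%N && (i %/ K < q)%N.
pose g' i := if at_k i then g (i %/ K)%N else fun=> 1.
pose e' i := if at_k i then e (i %/ K)%N else 1.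
have at_kE t (k' : 'I_K) : at_k (t * K + k')%N = (k' == k) && (t < q)%N.
  by rewrite /at_k modnMDl modn_small// divnMDl// divn_small ?addn0.
have divE t (k' : 'I_K) : ((t * K + k') %/ K = t)%N.
  by rewrite divnMDl// divn_small ?addn0.
have blocks (F G : nat -> R) : (forall t (k' : 'I_K), F (t * K + k')%N =
    if (k' == k) && (t < q)%N then G t else 1) ->
    \prod_(i < size (noise_sds sig2 n)) F i = \prod_(t < q) G t.
  move=> FG; rewrite size_noise_sds big_blocks.
  rewrite (eq_bigr (fun t : 'I_n => if (t < q)%N then G t else 1)).
    by rewrite -big_mkcond/= (big_ord_widen n (fun t => G t)).
  move=> t _; rewrite (bigD1 k)//= FG eqxx/= big1 ?mulr1// => k' /negbTE k'k.
  by rewrite FG k'k.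
have := @gauss_mean_prod _ (noise_sds sig2 n) g' e'; rewrite (blocks e' e); last first.
  by move=> t k'; rewrite /e' at_kE divE.
move=> H; apply: eq_gauss_mean (H _ _ _).
- move=> zs zsE.
  rewrite (blocks (fun i => g' i (nth 0 zs i)) (fun t => g t (noise_of zs t k)))//.
  move=> t k'; rewrite /g' at_kE divE; case: ifP => // /andP[/eqP -> _].
  by [].
- by move=> i _; rewrite /g'; case: ifP => // /andP[_ ?]; exact: mg.
- by move=> i x _; rewrite /g'; case: ifP => // /andP[_ ?]; exact: g0.
- move=> i; rewrite size_noise_sds => ilt; rewrite /g' /e'; case: ifPn => [|_].
    move=> /andP[/eqP ik iq]; rewrite [in nth _ _ _](divn_eq i K) ik nth_noise_sds.
      exact: ge.
    by rewrite (leq_trans iq).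
  by rewrite integral_normal_cst.
Qed.

Lemma noise_mean_coord t (k : 'I_K) (g : R -> R) (e : R) : (t < n)%N ->
  measurable_fun [set: measurableTypeR R] g -> (forall x, 0 <= g x) ->
  (\int[normal_prob 0 (Num.sqrt (sig2 k))]_x (g x)%:E = e%:E)%E ->
  noise_mean (fun z => g (z t k)) e.
Proof.
move=> tn mg g0 ge; apply: (@gauss_mean_coord _ _ (t * K + k)%N g e _ mg g0).
  by rewrite size_noise_sds noise_index_lt.
by rewrite nth_noise_sds.
Qed.

(** Dominates the indicator of [|x| >= delta]. The rate [1 / (4 * s2)] is half the critical one,
    which makes the mean finite with the constant [Num.sqrt 2]. *)
Definition tail_bound (s2 delta x : R) := expR ((x ^+ 2 - delta ^+ 2) / (4 * s2)).

Lemma tail_bound_ge1 s2 delta x : 0 < s2 -> 0 <= delta -> delta <= `|x| ->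
  1 <= tail_bound s2 delta x.
Proof.
move=> s20 delta0 dx; rewrite -expR0 ler_expR divr_ge0 ?mulr_ge0 ?(ltW s20)//.
by rewrite subr_ge0 -[x ^+ 2]real_normK ?num_real// lerXn2r// nnegrE.
Qed.

Lemma noise_mean_tail_bound t (k : 'I_K) (delta : R) : (t < n)%N -> 0 < sig2 k ->
  noise_mean (fun z => tail_bound (sig2 k) delta (z t k))
    (Num.sqrt 2 * expR (- (delta ^+ 2 / (4 * sig2 k)))).
Proof.
move=> tn s0; apply: noise_mean_coord => //.
- rewrite (_ : tail_bound _ _ = fun x => expR ((4 * sig2 k)^-1 * x ^+ 2 + 0 * x
    + - (delta ^+ 2 / (4 * sig2 k)))); first exact: measurable_expR_quadratic.
  by apply/funext => x; congr expR; field; rewrite gt_eqF.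
- by move=> x; exact: expR_ge0.
under eq_integral => x _.
  rewrite /tail_bound (_ : _ / _ = (4 * sig2 k)^-1 * x ^+ 2 + 0 * x
    + - (delta ^+ 2 / (4 * sig2 k))).
    over.
  by field; rewrite gt_eqF.
have sE : Num.sqrt (sig2 k) ^+ 2 = sig2 k by rewrite sqr_sqrtr// ltW.
have wE : 1 - 2 * (4 * sig2 k)^-1 * sig2 k = 2^-1.
  by field; rewrite gt_eqF.
rewrite integral_normal_expR_quadratic ?sqrtr_gt0 ?sE ?wE//; last first.
  by rewrite -subr_gt0 wE.
by rewrite expr0n/= !mul0r addr0 sqrtrV// invrK.
Qed.

End noise.

(** * The feedback scheme *)

Section noise_mean_closure.
Context {R : realType} {K : nat} (sig2 : 'I_K -> R) (n : nat).
Implicit Types f g : (nat -> 'I_K -> R) -> R.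

Lemma noise_meanD f g e1 e2 : noise_mean sig2 n f e1 -> noise_mean sig2 n g e2 ->
  noise_mean sig2 n (fun z => f z + g z) (e1 + e2).
Proof. exact: gauss_meanD. Qed.

Lemma noise_meanZ c f e : 0 <= c -> noise_mean sig2 n f e ->
  noise_mean sig2 n (fun z => c * f z) (c * e).
Proof. exact: gauss_meanZ. Qed.

Lemma noise_mean_sum (I : eqType) (r : seq I) (f : I -> (nat -> 'I_K -> R) -> R) e :
  (forall i, i \in r -> noise_mean sig2 n (f i) (e i)) ->
  noise_mean sig2 n (fun z => \sum_(i <- r) f i z) (\sum_(i <- r) e i).
Proof. exact: gauss_mean_sum. Qed.

Lemma noise_mean_cst c : 0 <= c -> noise_mean sig2 n (fun=> c) c.
Proof. exact: gauss_mean_cst. Qed.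

End noise_mean_closure.

Section trajectory.
Context {R : realType} {K Mn : nat} (S : fb_scheme R K Mn).
Variables (m : 'I_Mn) (z : nat -> 'I_K -> R).

Definition input_at i := enc S i m (traj S m z i).2.
Definition output_at k i := input_at i + z i k.

Lemma traj_inputs t : (traj S m z t).1.1 = mkseq input_at t.
Proof.
elim: t => // t ih; rewrite mkseqS -ih /input_at /=.
by case: (traj S m z t) => [[xs ys] vs].
Qed.

Lemma traj_outputs t k : (traj S m z t).1.2 k = mkseq (output_at k) t.
Proof.
elim: t => // t ih; rewrite mkseqS -ih /output_at /input_at /=.
by case: (traj S m z t) => [[xs ys] vs].
Qed.

Lemma traj_feedback t k : (traj S m z t).2 k =
  mkseq (fun i => fb S k i (mkseq (output_at k) i.+1)) t.
Proof.
elim: t => // t ih; rewrite mkseqS -ih [in fb _ _ _ _]mkseqS -traj_outputs.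
rewrite /output_at /input_at /=.
by case: (traj S m z t) => [[xs ys] vs].
Qed.

End trajectory.

Arguments input_at : simpl never.
Arguments output_at : simpl never.

Lemma divn_digits (B m m' : nat) d : (m < B ^ d)%N -> (m' < B ^ d)%N ->
  (forall j, (j < d)%N -> m %/ B ^ j = m' %/ B ^ j %[mod B])%N -> m = m'.
Proof.
elim: d m m' => [|d ih] m m' mB mB' mm'.
  by move: mB mB'; rewrite expn0 !ltnS !leqn0 => /eqP -> /eqP ->.
have m0 := mm' 0 isT; rewrite expn0 !divn1 in m0.
have B0 : (0 < B)%N by move: mB; case: (B) => //; rewrite exp0n.
rewrite (divn_eq m B) (divn_eq m' B) m0; congr (_ * _ + _)%N.
apply: ih; rewrite ?ltn_divLR// -?expnSr// => j jd.
by rewrite -!divnMA -expnS; exact: mm'.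
Qed.

Section scheme.
Context {R : realType} {K M : nat}.
Variables (v : 'I_K -> R) (p thr : R) (cs : seq (seq R)).
Variables (n1 d Lp B : nat) (Delta : nat -> R) (cutoff : R) (m0 : 'I_M).

Definition digit (m j : nat) := (m %/ B ^ j %% B)%N.

Definition info_test (k : 'I_K) (y : seq R) (c : seq R) : bool :=
  n1%:R * thr <= \sum_(t < n1) info_density p (v k) (nth 0 c t) (nth 0 y t).

(** Times count from 0 and slots [l] belong to phase [l.+1], so [(slot l 0).-1] is the last instant
    of phase [l], when the guess after it is fed back. *)
Definition slot l j := (n1 + l * d + j)%N.

Definition pam_test (l : nat) (y : seq R) (m : 'I_M) : bool :=
  [forall j : 'I_d,
    `|nth 0 y (slot l j) - Delta l * (digit m j).+1%:R| < Delta l / 2].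

(** If no word passes, [find] returns the length of the list and [insubd] falls back to [m0]. In a
    resending phase, an output that fits no message is read as silence and the old guess is kept. *)
Fixpoint guess (l : nat) (k : 'I_K) (y : seq R) : 'I_M :=
  match l with
  | 0 => insubd m0 (find (info_test k y) cs)
  | l'.+1 => odflt (guess l' k y) [pick m | pam_test l' y m]
  end.

(** Phase [0] uses the code [cs]; in phase [l.+1] the sender, having seen every
    receiver's guess after phase [l], is silent if all are right and otherwise
    repeats the message in base [B] over [d] slots with amplitude [Delta l].
    The digits are shifted by one to be distinguishable from silence.  The
    [cutoff] forces errors on a rare event: the error probability has to be
    positive since [ln 0 = 0]. *)
Definition resend_scheme : fb_scheme R K M := FbScheme
  (fun i m vs =>
    if (i < n1)%N then nth 0 (nth [::] cs m) i
    else let l := ((i - n1) %/ d)%N in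
      if [exists k, nth 0%N (vs k) (slot l 0).-1 != m]
      then Delta l * (digit m ((i - n1) %% d)).+1%:R else 0)
  (fun k i y => if [pick l : 'I_Lp | i.+1 == slot l 0] is Some l
                then guess l k y : nat else 0%N)
  (fun k y => if cutoff < nth 0 y 0 then m0 else guess Lp k y).

Let S := resend_scheme.
Let n := (n1 + Lp * d)%N.

Hypotheses (n10 : (0 < n1)%N) (d0 : (0 < d)%N) (szcs : size cs = M).
Hypotheses (MB : (M <= B ^ d)%N) (Delta0 : forall l, 0 < Delta l).

(** Causality: the guess fed back from a prefix equals the one computed from the full output, which
    is the one analysed. *)
Lemma eq_guess l k (y y' : seq R) :
  (forall i, (i < slot l 0)%N -> nth 0 y i = nth 0 y' i) ->
  guess l k y = guess l k y'.
Proof.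
elim: l => [|l ih] yy' /=.
  congr insubd; apply: eq_find => c; rewrite /info_test; congr (_ <= _).
  apply: eq_bigr => t _; rewrite yy'// /slot mul0n !addn0; exact: ltn_ord.
rewrite ih; last first.
  move=> i il; apply: yy'; apply: leq_trans il _.
  by rewrite /slot !addn0 leq_add2l leq_mul2r leqnSn orbT.
congr odflt; apply: eq_pick => m; rewrite /pam_test.
apply: eq_forallb => j; rewrite yy'// /slot addn0 mulSnr addnA ltn_add2l.
exact: ltn_ord.
Qed.

Variables (m : 'I_M) (z : nat -> 'I_K -> R).
Let X := input_at S m z.
Let Y := output_at S m z.

Definition guess_at l k := guess l k (mkseq (Y k) n).

Lemma input_code t : (t < n1)%N -> X t = nth 0 (nth [::] cs m) t.
Proof. by move=> tn1; rewrite /X /input_at /= tn1. Qed.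

Lemma slot_lt l j : (l < Lp)%N -> (j < d)%N -> (slot l j < n)%N.
Proof.
move=> lL jd; rewrite /slot /n -addnA ltn_add2l.
by apply: (@leq_trans (l.+1 * d)); rewrite ?leq_mul2r ?lL ?orbT// mulSnr ltn_add2l.
Qed.

Lemma feedback_at l k : (l < Lp)%N ->
  fb S k (slot l 0).-1 (mkseq (Y k) (slot l 0)) = guess_at l k.
Proof.
move=> lL /=; rewrite prednK; last by rewrite /slot addn0 addn_gt0 n10.
case: pickP => [l'|/(_ (Ordinal lL))]; last by rewrite eqxx.
rewrite /slot !addn0 eqn_add2l eqn_pmul2r// => /eqP <-; congr nat_of_ord.
apply: eq_guess => i; rewrite /slot addn0 => il; rewrite !nth_mkseq//.
by rewrite (leq_trans il)// /n leq_add2l leq_mul2r ltnW ?orbT.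
Qed.

Lemma input_slot l j : (l < Lp)%N -> (j < d)%N -> X (slot l j) =
  if [exists k, guess_at l k != m] then Delta l * (digit m j).+1%:R else 0.
Proof.
move=> lL jd; have s0 : (0 < slot l 0)%N by rewrite /slot addn0 addn_gt0 n10.
have sE : (slot l j - n1 = l * d + j)%N by rewrite /slot -addnA addKn.
rewrite /X /input_at /= sE divnMDl// divn_small// addn0 modnMDl modn_small//.
rewrite ltnNge {1}/slot -addnA leq_addr/=.
congr (if _ then _ else _); apply: eq_existsb => k.
rewrite traj_feedback nth_mkseq; last by rewrite prednK// /slot addn0 leq_addr.
by rewrite prednK// -[RHS]/(nat_of_ord (guess_at l k) != m) -feedback_at.
Qed.

(** Distinct digits are at least [Delta l] apart, and so are silence and any shifted digit; noise
    below half of that confuses neither. If the sender is silent, the kept guess was right. Nothing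
    is assumed about how earlier phases went. *)
Lemma guess_correct l k : (l < Lp)%N ->
  (forall j, (j < d)%N -> `|z (slot l j) k| < Delta l / 2) -> guess_at l.+1 k = m.
Proof.
move=> lL zsmall.
have D0 := Delta0 l; have D20 : 0 < Delta l / 2 by rewrite divr_gt0.
have yE j : (j < d)%N -> nth 0 (mkseq (Y k) n) (slot l j) = X (slot l j) + z (slot l j) k.
  by move=> jd; rewrite nth_mkseq// slot_lt.
rewrite /guess_at /= -/(guess_at l k).
have [[k' wrong]|allright] := EM (exists k, guess_at l k != m).
  have XE j : (j < d)%N -> X (slot l j) = Delta l * (digit m j).+1%:R.
    by move=> jd; rewrite input_slot//; case: existsP => // -[]; exists k'.
  case: pickP => [m'|/(_ m)/negP]; last first.
    case; apply/forallP => j; rewrite yE// XE// addrAC subrr add0r.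
    exact: zsmall.
  move=> /forallP passed /=; apply: val_inj => /=.
  apply: (@divn_digits B _ _ d); try exact: leq_trans (ltn_ord _) MB.
  move=> j jd; rewrite -/(digit m' j) -/(digit m j); apply: contrapT => dj.
  have := passed (Ordinal jd); rewrite yE// XE//=.
  set zj := z _ _; have := zsmall j jd; rewrite -/zj !ltr_norml => /andP[z1 z2] /andP[y1 y2].
  have [lt|lt|//] := ltngtP (digit m' j) (digit m j).
    have : (digit m' j).+2%:R <= (digit m j).+1%:R :> R by rewrite ler_nat.
    by rewrite -natr1; nra.
  have : (digit m j).+2%:R <= (digit m' j).+1%:R :> R by rewrite ler_nat.
  by rewrite -natr1; nra.
(* Silence: digit 0 of any message already fails its test, the shifted digit being at least 1. *)
case: pickP => [m' /forallP/(_ (Ordinal d0))|_ /=]; last first.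
  by apply/eqP/negPn/negP => wrong; apply: allright; exists k.
rewrite yE// input_slot//; case: existsP => // _; rewrite add0r /=.
set zj := z _ _; have := zsmall 0 d0; rewrite -/zj !ltr_norml => /andP[z1 z2] /andP[y1 y2].
have : 1 <= (digit m' 0).+1%:R :> R by rewrite ler1n.
by move: D0 => *; exfalso; nra.
Qed.

(** The decoder errs only if the sent word fails the test or an earlier word passes it; in either
    case the corresponding exponential is at least 1. *)
Lemma guess0_bound s k : 0 <= s -> guess_at 0 k != m ->
  1 <= awgn_err_bound p (v k) s thr n1 cs m (fun t => z t k).
Proof.
move=> s0 wrong; rewrite /awgn_err_bound.
set c := nth [::] cs m; set y := mkseq (Y k) n.
have yE (t : 'I_n1) : nth 0 y t = nth 0 c t + z t k.
  by rewrite nth_mkseq ?(leq_trans (ltn_ord t) (leq_addr _ _))// /Y /output_at -/X input_code.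
have testE c' : info_test k y c' = (n1%:R * thr <= \sum_(t < n1)
    info_density p (v k) (nth 0 c' t) (nth 0 c t + z t k)).
  by rewrite /info_test; under eq_bigr do rewrite yE.
have sum0 : 0 <= \sum_(j < m) expR (- (n1%:R * thr)) * \prod_(t < n1)
    expR (info_density p (v k) (nth 0 (nth [::] cs j) t) (nth 0 c t + z t k)).
  by apply: sumr_ge0 => j _; rewrite mulr_ge0 ?prodr_ge0.
have [pass|fail] := boolP (info_test k y c); last first.
  rewrite -[leLHS]addr0 lerD// -expR_sum -expRD -[leLHS]expR0 ler_expR.
  move: fail; rewrite testE -ltNge => /ltW fail.
  by rewrite -mulr_sumr mulNr -mulrBr mulr_ge0// subr_ge0.
have has_pass : has (info_test k y) cs.
  by apply/(has_nthP [::]); exists m; rewrite ?szcs.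
have jm : (find (info_test k y) cs < m)%N.
  rewrite ltn_neqAle; apply/andP; split; last first.
    by rewrite leqNgt; apply/negP => /(before_find [::]); rewrite pass.
  apply: contra wrong => /eqP fm; apply/eqP; rewrite /guess_at /= -/y fm.
  by apply: val_inj; rewrite /= val_insubd ltn_ord.
rewrite -[leLHS]add0r lerD ?mulr_ge0 ?prodr_ge0//.
rewrite (bigD1 (Ordinal jm))//= -[leLHS]addr0 lerD ?sumr_ge0//; last first.
  by move=> j _; rewrite mulr_ge0 ?prodr_ge0.
have := nth_find [::] has_pass; rewrite testE => passj.
by rewrite -expR_sum -expRD -[leLHS]expR0 ler_expR addrC subr_ge0.
Qed.

End scheme.

(** * Measurability and entropy *)

Section discrete_measurable.
Context {disp : measure_display} {T : measurableType disp}.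

(** Stated pointwise, as in [scheme_measurable], so that the target needs no sigma-algebra;
    countability of intermediate types makes it stable under composition. *)
Definition discrete_measurable {D : Type} (f : T -> D) :=
  forall a, measurable [set y | f y = a].

Lemma discrete_measurable_cst {D : Type} (c : D) : discrete_measurable (fun=> c).
Proof.
move=> a; have [ca|ca] := EM (c = a).
  by rewrite (_ : [set _ | _] = setT)//; apply/seteqP; split.
by rewrite (_ : [set _ | _] = set0)//; apply/seteqP; split.
Qed.

Lemma discrete_measurable_comp {D : countType} {E : Type} (f : T -> D) (g : D -> E) :
  discrete_measurable f -> discrete_measurable (g \o f).
Proof.
move=> mf a; rewrite (_ : [set _ | _] = \bigcup_(i in [set i : nat |
    exists2 x : D, pickle x = i & g x = a]) [set y | pickle (f y) = i]).
  apply: bigcup_measurable => _ [x <- _].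
  rewrite (_ : [set _ | _] = [set y | f y = x]); first exact: mf.
  by apply/seteqP; split => y /= => [/(pcan_inj pickleK)|->].
apply/seteqP; split => y /=.
  by move=> gfa; exists (pickle (f y)) => //=; exists (f y).
by move=> [i [x <- <-]] /= /(pcan_inj pickleK) ->.
Qed.

Lemma discrete_measurable_pair {D E : Type} (f : T -> D) (g : T -> E) :
  discrete_measurable f -> discrete_measurable g ->
  discrete_measurable (fun y => (f y, g y)).
Proof.
move=> mf mg [a b]; rewrite (_ : [set _ | _] = [set y | f y = a] `&` [set y | g y = b]).
  exact: measurableI.
by apply/seteqP; split => y /= [-> ->].
Qed.

Lemma discrete_measurable_ffun {I : finType} {D : Type} (f : I -> T -> D) :
  (forall i, discrete_measurable (f i)) ->
  discrete_measurable (fun y => [ffun i => f i y]).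
Proof.
move=> mf a; rewrite (_ : [set _ | _] = \bigcap_(i in [set: I]) [set y | f i y = a i]).
  by apply: fin_bigcap_measurable => // i _; exact: mf.
apply/seteqP; split => y /=.
  by move=> <- i _ /=; rewrite ffunE.
by move=> fa; apply/ffunP => i; rewrite ffunE fa.
Qed.

Lemma discrete_measurable_bool (f : T -> bool) :
  measurable_fun [set: T] f -> discrete_measurable f.
Proof. by move=> mf a; have := mf measurableT [set a]; rewrite setTI; apply. Qed.

Lemma discrete_measurable_forall {I : finType} (f : I -> T -> bool) :
  (forall i, discrete_measurable (f i)) ->
  discrete_measurable (fun y => [forall i, f i y]).
Proof.
move=> /discrete_measurable_ffun/(discrete_measurable_comp
  (fun F : {ffun I -> bool} => [forall i, F i])).
by congr discrete_measurable; apply/funext => y /=; apply: eq_forallb => i; rewrite ffunE.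
Qed.

Lemma discrete_measurable_find {A : Type} (test : T -> A -> bool) (s : seq A) :
  (forall a, discrete_measurable (test^~ a)) ->
  discrete_measurable (fun y => find (test y) s).
Proof.
move=> mt; elim: s => [|a s ih] /=; first exact: discrete_measurable_cst.
exact: (discrete_measurable_comp (fun b : bool * nat => if b.1 then 0%N else b.2.+1)
  (discrete_measurable_pair (mt a) ih)).
Qed.

End discrete_measurable.

Lemma measurable_nth_tuple {R : realType} (N i : nat) :
  measurable_fun [set: N.-tuple (measurableTypeR R)] (fun y => nth 0 y i : measurableTypeR R).
Proof.
have [iN|Ni] := ltnP i N.
  rewrite (_ : (fun _ => _) = fun y : N.-tuple (measurableTypeR R) => tnth y (Ordinal iN)).
    exact: measurable_tnth.
  by apply/funext => y; rewrite (tnth_nth 0).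
rewrite (_ : (fun _ => _) = fun=> 0)//.
by apply/funext => y; rewrite nth_default// size_tuple.
Qed.

Section scheme_measurability.
Context {R : realType} {K M : nat}.
Variables (v : 'I_K -> R) (p thr : R) (cs : seq (seq R)).
Variables (n1 d Lp B : nat) (Delta : nat -> R) (cutoff : R) (m0 : 'I_M).

Lemma measurable_info_test (N : nat) k c :
  discrete_measurable (fun y : N.-tuple R => info_test v p thr n1 k y c).
Proof.
apply: discrete_measurable_bool; apply: measurable_fun_ler => //.
apply: measurable_sum => t; rewrite /info_density.
apply: measurable_funB; first apply: measurable_funD => //.
  apply: measurable_funM => //; apply: measurable_funX.
  exact: measurable_nth_tuple.
apply: measurable_funM => //; apply: measurable_funX.
by apply: measurable_funB => //; exact: measurable_nth_tuple.
Qed.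

Lemma measurable_pam_test (N : nat) l (m : 'I_M) :
  discrete_measurable (fun y : N.-tuple R => pam_test n1 d B Delta l y m).
Proof.
apply: discrete_measurable_forall => j; apply: discrete_measurable_bool.
apply: measurable_fun_ltr => //; apply: measurableT_comp => //.
by apply: measurable_funB => //; exact: measurable_nth_tuple.
Qed.

Lemma measurable_guess (N l : nat) k :
  discrete_measurable (fun y : N.-tuple R => guess v p thr cs n1 d B Delta m0 l k y).
Proof.
elim: l => [|l ih] /=.
  apply: (discrete_measurable_comp (insubd m0) _).
  by apply: discrete_measurable_find => c; exact: measurable_info_test.
have := discrete_measurable_comp
  (fun b : 'I_M * {ffun 'I_M -> bool} => odflt b.1 [pick m | b.2 m])
  (discrete_measurable_pair ih (discrete_measurable_ffun (@measurable_pam_test N l))).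
congr discrete_measurable; apply/funext => y /=; congr odflt.
by apply: eq_pick => m; rewrite ffunE.
Qed.

Lemma resend_scheme_measurable (n : nat) :
  scheme_measurable n (resend_scheme v p thr cs n1 d Lp B Delta cutoff m0).
Proof.
split=> [k i c _|k m] /=.
  case: pickP => [l _|_]; last exact: (discrete_measurable_cst 0%N c).
  exact: (discrete_measurable_comp (@nat_of_ord M) (@measurable_guess i.+1 l k) c).
have mcut : discrete_measurable (fun y : n.-tuple R => cutoff < nth 0 y 0).
  by apply: discrete_measurable_bool; apply: measurable_fun_ltr => //; exact: measurable_nth_tuple.
exact: (discrete_measurable_comp
  (fun b : bool * 'I_M => if b.1 then m0 else b.2)
  (discrete_measurable_pair mcut (@measurable_guess n Lp k)) m).
Qed.

End scheme_measurability.

Section entropy.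
Context {R : realType}.

(** Superadditivity gives total mass S at most 1, not equal to 1. For such a defective law the usual
    argument leaves the error term (1 - S)(ln M - 1), which has the right sign once M is at least
    e. *)
Lemma entropy_le_ln (M : nat) (p : nat -> R) : expR 1 <= M%:R :> R ->
  (forall i, 0 <= p i) -> (forall i, (M <= i)%N -> p i = 0) ->
  \sum_(i < M) p i <= 1 -> (entropy p <= (ln M%:R)%:E)%E.
Proof.
move=> Me p0 pM S1.
have M0 : 0 < M%:R :> R by exact: lt_le_trans (expR_gt0 1) Me.
have pile1 i : p i <= 1.
  have [iM|/pM ->//] := ltnP i M; apply: le_trans S1.
  by rewrite (bigD1 (Ordinal iM))//= lerDl sumr_ge0.
have lnM1 : 1 <= ln (M%:R : R).
  by rewrite -[leLHS]expRK ler_ln ?posrE ?expR_gt0.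
have term0 i : (0 <= (- (p i * ln (p i)))%:E)%E.
  by rewrite lee_fin oppr_ge0 mulr_ge0_le0// ln_le0.
rewrite /entropy (nneseries_split 0 M)// add0n.
rewrite [X in (_ + X)%E]eseries0 ?adde0; last first.
  by move=> i Mi _; rewrite pM// mul0r oppr0.
rewrite sumEFin lee_fin big_mkord.
(* Gibbs' inequality term by term, from ln x <= x - 1 at x = 1 / ([p i] M). *)
apply: (@le_trans _ _ (\sum_(i < M) (p i * ln M%:R + (M%:R^-1 - p i)))).
  apply: ler_sum => i _.
  have := p0 i; rewrite le_eqVlt => /predU1P[<-|pi0].
    by rewrite !mul0r oppr0 add0r addr0 invr_ge0 ltW.
  have : ln (p i * M%:R)^-1 <= (p i * M%:R)^-1 - 1.
    have := @le_ln1Dx R ((p i * M%:R)^-1 - 1); rewrite addrCA subrr addr0; apply.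
    by rewrite ltrBrDl subrr invr_gt0 mulr_gt0.
  rewrite lnV ?posrE ?mulr_gt0// lnM ?posrE// => h.
  have := ler_wpM2l (p0 i) h.
  rewrite mulrBr mulr1 invfM mulrA divff ?gt_eqF// mul1r; lra.
rewrite big_split/= -mulr_suml big_split/= sumr_const card_ord sumrN.
rewrite -[_^-1 *+ _]mulr_natl divff ?gt_eqF//.
have : 0 <= (1 - \sum_(i < M) p i) * (ln M%:R - 1) by rewrite mulr_ge0 ?subr_ge0.
by set S := \sum_(i < M) p i; set l := ln _; nra.
Qed.

End entropy.

(** * Performance of the scheme *)

Section joint_expectation.
Context {R : realType} {K Mn : nat} (sig2 : 'I_K -> R) (n : nat).
Implicit Types f : 'I_Mn -> (nat -> 'I_K -> R) -> \bar R.

Let inv_ge0 : (0 <= (Mn%:R^-1 : R)%:E)%E.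
Proof. by rewrite lee_fin invr_ge0. Qed.

Lemma le_jointE f g : (forall m z, 0 <= f m z)%E -> (forall m z, f m z <= g m z)%E ->
  (jointE sig2 n f <= jointE sig2 n g)%E.
Proof.
move=> f0 fg; apply: lee_wpmul2l => //; apply: lee_sum => m _.
by apply: le_gauss_iter => zs _; [exact: f0|exact: fg].
Qed.

Lemma jointE_ge0 f : (forall m z, 0 <= f m z)%E -> (0 <= jointE sig2 n f)%E.
Proof.
move=> f0; apply: mule_ge0 => //; apply: sume_ge0 => m _.
by apply: gauss_iter_ge0 => zs _; exact: f0.
Qed.

Lemma jointE_mean (g : 'I_Mn -> (nat -> 'I_K -> R) -> R) (e : 'I_Mn -> R) :
  (forall m, noise_mean sig2 n (g m) (e m)) ->
  jointE sig2 n (fun m z => (g m z)%:E) = (Mn%:R^-1 * \sum_(m < Mn) e m)%:E.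
Proof.
move=> ge; rewrite /jointE EFinM -sumEFin; congr (_ * _)%E.
by apply: eq_bigr => m _; exact: noiseE_mean.
Qed.

Lemma jointE1 : (0 < Mn)%N -> jointE sig2 n (fun (_ : 'I_Mn) _ => 1%E) = 1%E :> \bar R.
Proof.
move=> M0; rewrite (@jointE_mean (fun=> fun=> 1) (fun=> 1)); last first.
  by move=> m; exact: noise_mean_cst.
by rewrite sumr_const card_ord -[1 *+ Mn]/(Mn%:R) mulVf// pnatr_eq0 -lt0n.
Qed.

Lemma superadditive_jointE_sum (I : Type) (r : seq I) (f : I -> 'I_Mn -> _ -> \bar R) :
  (forall i m z, 0 <= f i m z)%E ->
  (\sum_(i <- r) jointE sig2 n (f i)
     <= jointE sig2 n (fun m z => \sum_(i <- r) f i m z))%E.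
Proof.
move=> f0; rewrite /jointE -ge0_sume_distrr; last first.
  move=> i _; apply: sume_ge0 => m _.
  by apply: gauss_iter_ge0 => zs _; exact: f0.
apply: lee_wpmul2l => //; rewrite exchange_big/=; apply: lee_sum => m _.
exact: (superadditive_gauss_iter_sum r (fun i zs _ => f0 i m (noise_of zs))).
Qed.

Definition discrete_law (V : 'I_Mn -> (nat -> 'I_K -> R) -> nat) (i : nat) : R :=
  fine (jointE sig2 n (fun m z => ((V m z == i)%:R)%:E)).

Hypothesis Mn0 : (0 < Mn)%N.
Variable V : 'I_Mn -> (nat -> 'I_K -> R) -> nat.

Let pge0 i (m : 'I_Mn) z : (0 <= ((V m z == i)%:R : R)%:E)%E.
Proof. by rewrite lee_fin. Qed.

Let pfin i : (jointE sig2 n (fun m z => ((V m z == i)%:R)%:E) \is a fin_num)%E.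
Proof.
rewrite ge0_fin_numE ?jointE_ge0//; apply: (@le_lt_trans _ _ 1%E); last exact: ltry.
by rewrite -jointE1//; apply: le_jointE => // m z; rewrite lee_fin lern1 leq_b1.
Qed.

Lemma discrete_law_ge0 i : 0 <= discrete_law V i.
Proof. by apply: fine_ge0; exact: jointE_ge0. Qed.

Lemma discrete_law_eq0 i : (forall m z, V m z != i) -> discrete_law V i = 0.
Proof.
move=> Vi; rewrite /discrete_law (_ : (fun _ => _) = fun=> fun=> 0%:E); last first.
  by apply/funext => m; apply/funext => z; rewrite (negbTE (Vi m z)).
by rewrite (@jointE_mean (fun=> fun=> 0) (fun=> 0))/= ?big1 ?mulr0// => m; exact: noise_mean_cst.
Qed.

Lemma discrete_law_sum_le1 N : \sum_(i < N) discrete_law V i <= 1.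
Proof.
rewrite -lee_fin -sumEFin -(big_mkord xpredT (fun i => (discrete_law V i)%:E)).
under eq_bigr do rewrite fineK//.
apply: le_trans (superadditive_jointE_sum _ pge0) _.
rewrite -jointE1//; apply: le_jointE => m z; first by apply: sume_ge0.
rewrite sumEFin lee_fin.
have [VN|NV] := ltnP (V m z) N.
  rewrite big_mkord (bigD1 (Ordinal VN))//= eqxx big1 ?addr0// => j.
  by rewrite -val_eqE/= eq_sym => /negbTE ->.
rewrite big_mkord big1// => j _; case: eqP => // Vj.
by move: NV; rewrite Vj leqNgt ltn_ord.
Qed.

(** For the times at which no guess is sent: the constant signal there is free. *)
Lemma entropy_discrete_law_const c : (forall m z, V m z = c) -> entropy (discrete_law V) = 0%E.
Proof.
move=> Vc; rewrite /entropy eseries0// => i _ _.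
have [->|ic] := eqVneq i c.
  rewrite /discrete_law (_ : (fun _ => _) = fun=> fun=> 1%E) ?jointE1//=.
    by rewrite ln1 mulr0 oppr0.
  by apply/funext => m; apply/funext => z; rewrite Vc eqxx.
by rewrite discrete_law_eq0 ?mul0r ?oppr0// => m z; rewrite Vc eq_sym.
Qed.

Lemma entropy_discrete_law_le N : expR 1 <= N%:R :> R -> (forall m z, (V m z < N)%N) ->
  (entropy (discrete_law V) <= (ln N%:R)%:E)%E.
Proof.
move=> Ne VN; apply: entropy_le_ln => // [i|i Ni|].
- exact: discrete_law_ge0.
- by apply: discrete_law_eq0 => m z; rewrite ltn_eqF// (leq_trans (VN m z)).
- exact: discrete_law_sum_le1.
Qed.

End joint_expectation.

Lemma measurable_info_density_shift {R : realType} (p v x a : R) :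
  measurable_fun [set: measurableTypeR R] (fun z => info_density p v x (a + z)).
Proof.
apply: measurable_funB; first apply: measurable_funD => //.
  by apply: measurable_funM => //; apply: measurable_funX; exact: measurable_funD.
apply: measurable_funM => //; apply: measurable_funX.
by apply: measurable_funB => //; exact: measurable_funD.
Qed.

Lemma normal_tail_gt0 {R : realType} (sd a : R) : 0 < sd ->
  exists2 e : R, 0 < e & (\int[normal_prob 0 sd]_x (\1_(`]a, +oo[%classic) x : R)%:E = e%:E)%E.
Proof.
move=> sd0; set I := (\int[_]_x _)%E.
have f01 (x : R) : 0 <= (\1_(`]a, +oo[%classic) x : R) <= 1.
  by rewrite indicE; case: (_ \in _); rewrite ?lexx ?ler01.
have mf : measurable_fun [set: measurableTypeR R]
    (fun x : R => (\1_(`]a, +oo[%classic) x : R)%:E).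
  by apply/measurable_EFinP; exact: measurable_indic.
have I1 : (I <= 1)%E.
  rewrite -(integral_normal_cst sd 1); apply: le_integral_nonmeasurable => x.
    by rewrite lee_fin; case/andP: (f01 x).
  by rewrite lee_fin; case/andP: (f01 x).
(* A lower bound for the density on the unit interval []a, a + 1]], where |x| <= |a| + 1. *)
pose c := normal_peak sd * expR (- (`|a| + 1) ^+ 2 / (sd ^+ 2 *+ 2)).
have c0 : 0 < c by rewrite mulr_gt0 ?expR_gt0// normal_peak_gt0 ?gt_eqF.
have cI : (c%:E <= I)%E.
  rewrite /I integral_normal_prob//.
  have -> : c%:E = (\int[lebesgue_measure]_x (c%:E * (\1_(`]a, (a + 1)]%classic : set R) x)%:E))%E.
    rewrite ge0_integralZl//=.
    - rewrite integral_indic//= setIT lebesgue_measure_itv/= lte_fin ltrDl ltr01.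
      by rewrite -EFinD addrAC subrr add0r mule1.
    - by apply/measurable_EFinP; exact: measurable_indic.
    - by rewrite lee_fin ltW.
  apply: le_integral_nonmeasurable => x.
    by rewrite mule_ge0// lee_fin ?ltW.
  rewrite !indicE !mem_setE/= !in_itv/= andbT.
  case: (boolP (a < x <= a + 1)) => [|_]; last by rewrite mule0 mule_ge0// lee_fin normal_pdf_ge0.
  move=> /andP[ax xa]; rewrite ax mule1 mul1e lee_fin /normal_pdf gt_eqF//.
  rewrite /c ler_wpM2l ?normal_peak_ge0// ler_expR subr0.
  rewrite ler_wpM2r ?invr_ge0 ?mulrn_wge0 ?sqr_ge0// lerN2.
  rewrite -[x ^+ 2]real_normK ?num_real// lerXn2r ?nnegrE ?addr_ge0//.
  rewrite ler_norml; apply/andP; split.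
    by have := ler_norm (- a); rewrite normrN; lra.
  by have := ler_norm a; lra.
have Ifin : I \is a fin_num.
  rewrite ge0_fin_numE; first by apply: le_lt_trans I1 _; exact: ltry.
  by apply: le_trans cI; rewrite lee_fin ltW.
by exists (fine I); rewrite ?fineK// (lt_le_trans c0)// -lee_fin fineK.
Qed.

Section scheme_performance.
Context {R : realType} {K M : nat}.
Variables (v : 'I_K -> R) (p thr : R) (cs : seq (seq R)).
Variables (n1 d Lp B : nat) (Delta : nat -> R) (cutoff : R) (m0 : 'I_M).
Hypotheses (n10 : (0 < n1)%N) (d0 : (0 < d)%N) (B0 : (0 < B)%N) (szcs : size cs = M).
Hypotheses (MB : (M <= B ^ d)%N) (Delta0 : forall l, 0 < Delta l).
Hypotheses (p0 : 0 < p) (v0 : forall k, 0 < v k).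
Variable s : R.
Hypotheses (s0 : 0 <= s) (s1 : s <= 1).

Local Notation S := (resend_scheme v p thr cs n1 d Lp B Delta cutoff m0).
Local Notation n := (n1 + Lp * d)%N.
Local Notation guess_at := (guess_at v p thr cs n1 d Lp B Delta cutoff m0).
Implicit Types (m : 'I_M) (z : nat -> 'I_K -> R).

Let M0 : (0 < M)%N. Proof. exact: leq_ltn_trans (leq0n m0) (ltn_ord m0). Qed.

(** Dominates the indicator that some receiver's guess after stage [l] is wrong. *)
Definition stage_bound l m z :=
  if l is l'.+1 then
    \sum_(k < K) \sum_(j < d) tail_bound (v k) (Delta l' / 2) (z (slot n1 d l' j) k)
  else \sum_(k < K) awgn_err_bound p (v k) s thr n1 cs m (fun t => z t k).

Definition stage_mean l m :=
  if l is l'.+1 then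
    \sum_(k < K) \sum_(j < d) Num.sqrt 2 * expR (- ((Delta l' / 2) ^+ 2 / (4 * v k)))
  else \sum_(k < K) awgn_err_mean p (v k) s thr n1 cs m.

Lemma awgn_err_bound_ge0 k m z :
  0 <= awgn_err_bound p (v k) s thr n1 cs m (fun t => z t k).
Proof.
rewrite addr_ge0 ?sumr_ge0// => [|j _]; by rewrite mulr_ge0 ?prodr_ge0.
Qed.

Lemma stage_bound_ge0 l m z : 0 <= stage_bound l m z.
Proof.
case: l => [|l] /=; first by apply: sumr_ge0 => k _; exact: awgn_err_bound_ge0.
by apply: sumr_ge0 => k _; apply: sumr_ge0 => j _; exact: expR_ge0.
Qed.

Lemma stage_bound_ge1 l m z : (l <= Lp)%N -> [exists k, guess_at m z l k != m] ->
  1 <= stage_bound l m z.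
Proof.
case: l => [|l] lL /existsP[k wrong].
  apply: le_trans (guess0_bound szcs s0 wrong) _.
  by rewrite /= (bigD1 k)//= lerDl sumr_ge0// => *; exact: awgn_err_bound_ge0.
have /existsP[j big_noise] : [exists j : 'I_d, Delta l / 2 <= `|z (slot n1 d l j) k|].
  apply: contraT => /existsPn small; case/eqP: wrong.
  apply: guess_correct => // j jd; have := small (Ordinal jd).
  by rewrite -ltNge.
rewrite /= (bigD1 k)//= (bigD1 j)//= -addrA -[leLHS]addr0 lerD//.
  by apply: tail_bound_ge1 => //; rewrite divr_ge0// ltW.
rewrite addr_ge0// sumr_ge0// => [i _|i _]; first exact: expR_ge0.
by apply: sumr_ge0 => h _; exact: expR_ge0.
Qed.

Lemma noise_mean_stage_bound l m : (l <= Lp)%N ->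
  noise_mean v n (stage_bound l m) (stage_mean l m).
Proof.
case: l => [_|l lL] /=.
  apply: noise_mean_sum => k _; apply: noise_meanD.
    apply: noise_meanZ; first exact: expR_ge0.
    pose c := nth [::] cs m.
    apply: (@noise_mean_prod _ _ v _ n1 k
      (fun t x => expR (- s * info_density p (v k) (nth 0 c t) (nth 0 c t + x)))
      (fun t => under_mean p (v k) s (nth 0 c t))).
    - exact: leq_addr.
    - by move=> t _; apply: measurableT_comp => //; apply: measurable_funM => //; exact: measurable_info_density_shift.
    - by move=> t x _; exact: expR_ge0.
    - by move=> t _; exact: integral_expRN_info_density.
  apply: noise_mean_sum => j _; apply: noise_meanZ; first exact: expR_ge0.
  apply: (@noise_mean_prod _ _ v _ n1 k
      (fun t x => expR (info_density p (v k) (nth 0 (nth [::] cs j) t) (nth 0 (nth [::] cs m) t + x)))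
      (fun t => over_mean p (v k) (nth 0 (nth [::] cs m) t) (nth 0 (nth [::] cs j) t))).
  - exact: leq_addr.
  - by move=> t _; apply: measurableT_comp => //; exact: measurable_info_density_shift.
  - by move=> t x _; exact: expR_ge0.
  - by move=> t _; exact: integral_expR_info_density.
apply: noise_mean_sum => k _; apply: noise_mean_sum => j _.
by apply: noise_mean_tail_bound => //; exact: slot_lt.
Qed.

(** Phase [l.+1] spends energy only if some guess after phase [l] is wrong, and then [stage_bound l]
    is at least 1. The shifted digits are at most [B]. *)
Lemma input_energy_le P1 m z :
  \sum_(t < n1) nth 0 (nth [::] cs m) t ^+ 2 <= n1%:R * P1 ->
  \sum_(x <- (traj S m z n).1.1) x ^+ 2 <=
    n1%:R * P1 + \sum_(l < Lp) d%:R * (Delta l * B%:R) ^+ 2 * stage_bound l m z.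
Proof.
move=> power; rewrite traj_inputs big_map -[n in iota 0 n]subn0 big_mkord.
rewrite big_split_ord/=; apply: lerD.
  by apply: le_trans power; apply: ler_sum => t _; rewrite input_code.
rewrite (big_blocks _ Lp d (fun i => input_at S m z (n1 + i) ^+ 2)).
apply: ler_sum => l _.
have -> : d%:R * (Delta l * B%:R) ^+ 2 * stage_bound l m z =
    \sum_(j < d) (Delta l * B%:R) ^+ 2 * stage_bound l m z.
  by rewrite sumr_const card_ord -[RHS]mulr_natl mulrA.
apply: ler_sum => j _; rewrite addnA -/(slot n1 d l j) input_slot//.
case: ifPn => [wrong|_]; last first.
  by rewrite expr0n/= mulr_ge0 ?sqr_ge0 ?stage_bound_ge0.
rewrite -[leLHS]mulr1 ler_pM ?sqr_ge0//; last first.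
  by apply: stage_bound_ge1 => //; exact: ltnW.
have D0 := ltW (Delta0 l).
rewrite lerXn2r ?nnegrE ?mulr_ge0// ler_wpM2l// ler_nat.
by rewrite /digit ltn_mod.
Qed.

Lemma power_ok_resend P1 P :
  (forall m, \sum_(t < n1) nth 0 (nth [::] cs m) t ^+ 2 <= n1%:R * P1) ->
  n1%:R * P1 + \sum_(l < Lp) d%:R * (Delta l * B%:R) ^+ 2 *
    (M%:R^-1 * \sum_(m < M) stage_mean l m) <= n%:R * P ->
  power_ok v n S P.
Proof.
move=> power leP; rewrite /power_ok.
have P10 : 0 <= n1%:R * P1 by apply: le_trans (power m0); apply: sumr_ge0 => t _; exact: sqr_ge0.
apply: (@le_trans _ _ (jointE v n (fun m z => (n1%:R * P1 +
    \sum_(l < Lp) d%:R * (Delta l * B%:R) ^+ 2 * stage_bound l m z)%:E))).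
  apply: le_jointE => m z; rewrite lee_fin; first by apply: sumr_ge0 => x _; exact: sqr_ge0.
  exact: input_energy_le.
rewrite (@jointE_mean _ _ _ _ _ _ (fun m => n1%:R * P1 +
    \sum_(l < Lp) d%:R * (Delta l * B%:R) ^+ 2 * stage_mean l m)); last first.
  move=> m; apply: noise_meanD; first exact: noise_mean_cst.
  apply: noise_mean_sum => l _; apply: noise_meanZ; first by rewrite mulr_ge0 ?sqr_ge0.
  by apply: noise_mean_stage_bound; exact: ltnW.
rewrite lee_fin; apply: le_trans leP; rewrite big_split/= mulrDr.
have MR0 : M%:R != 0 :> R by rewrite pnatr_eq0 -lt0n.
rewrite sumr_const card_ord -[(n1%:R * P1) *+ M]mulr_natl mulKf// lerD2l.
rewrite exchange_big/= mulr_sumr; apply: ler_sum => l _.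
by rewrite -mulr_sumr mulrCA.
Qed.

Lemma feedback_rate_ok_resend Rfb : expR 1 <= M%:R :> R ->
  Lp%:R * ln M%:R <= n%:R * Rfb -> feedback_rate_ok v n S Rfb.
Proof.
move=> Me LR k.
have lnM0 : 0 <= ln (M%:R : R) by rewrite ln_ge0// ler1n.
have nthE i m z : (i < n)%N -> nth 0%N ((traj S m z n).2 k) i =
    if [pick l : 'I_Lp | i.+1 == slot n1 d l 0] is Some l
    then guess v p thr cs n1 d B Delta m0 l k (mkseq (output_at S m z k) i.+1) : nat else 0%N.
  by move=> iltn; rewrite traj_feedback nth_mkseq.
(* Each instant is charged [ln M] per guess sent at it; after exchanging the sums, each of the [Lp]
   guesses is charged at most once. *)
apply: (@le_trans _ _ (\sum_(i < n) (\sum_(l < Lp) (i.+1 == slot n1 d l 0)%:R * ln M%:R)%:E)%E).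
  apply: lee_sum => i _.
  have -> : fb_pmf v n S k i = discrete_law v n (fun m z => nth 0%N ((traj S m z n).2 k) i) by [].
  case: (pickP [pred l : 'I_Lp | i.+1 == slot n1 d l 0]) => [l il|none].
    apply: (@le_trans _ _ (ln M%:R)%:E).
      apply: entropy_discrete_law_le => // m z; rewrite nthE//.
      by case: pickP => // l' _; exact: ltn_ord.
    rewrite lee_fin (bigD1 l)//= (eqP il) eqxx mul1r lerDl.
    by apply: sumr_ge0 => l' _; rewrite mulr_ge0.
  rewrite (@entropy_discrete_law_const _ _ _ _ _ M0 _ 0%N).
    by rewrite lee_fin; apply: sumr_ge0 => l' _; rewrite mulr_ge0.
  by move=> m z; rewrite nthE//; case: pickP => // l il; have := none l; rewrite /= il.
rewrite sumEFin lee_fin; apply: le_trans LR; rewrite exchange_big/=.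
have -> : Lp%:R * ln M%:R = \sum_(l < Lp) ln (M%:R : R).
  by rewrite sumr_const card_ord -[RHS]mulr_natl.
apply: ler_sum => l _; rewrite -mulr_suml -[leRHS]mul1r ler_wpM2r//.
rewrite -natr_sum lern1.
have [/existsP[i0 i0P]|/existsPn none] := boolP [exists i : 'I_n, i.+1 == slot n1 d l 0].
  rewrite (bigD1 i0)//= i0P big1 ?addn0// => i ii0.
  by rewrite -(eqP i0P) eqSS val_eqE (negbTE ii0).
by rewrite big1// => i _; rewrite (negbTE (none i)).
Qed.

Definition error_mean theta m :=
  stage_mean Lp m + \sum_(k < K) Num.sqrt 2 * expR (- (theta ^+ 2 / (4 * v k))).

(** The cutoff exceeds every first code letter by [theta], so it can be crossed only when the first
    noise exceeds [theta]; this is the second sum in [error_mean]. *)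
Lemma error_prob_le theta : 0 <= theta ->
  (forall m, `|nth 0 (nth [::] cs m) 0| + theta <= cutoff) ->
  error_prob v n S <= M%:R^-1 * \sum_(m < M) error_mean theta m.
Proof.
move=> theta0 cut.
have nn0 : (0 < n)%N by rewrite addn_gt0 n10.
have mean m : noise_mean v n (fun z => stage_bound Lp m z +
    \sum_(k < K) tail_bound (v k) theta (z 0%N k)) (error_mean theta m).
  apply: noise_meanD; first exact: noise_mean_stage_bound.
  by apply: noise_mean_sum => k _; exact: noise_mean_tail_bound.
have dom m z : (((if [exists k, dec S k ((traj S m z n).1.2 k) != m] then 1 else 0) : R)%:E
    <= (stage_bound Lp m z + \sum_(k < K) tail_bound (v k) theta (z 0%N k))%:E)%E.
  have sb0 := stage_bound_ge0 Lp m z.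
  have tb0 : 0 <= \sum_(k < K) tail_bound (v k) theta (z 0%N k).
    by apply: sumr_ge0 => k _; exact: expR_ge0.
  rewrite lee_fin; case: ifPn => [/existsP[k]|_]; last exact: addr_ge0.
  rewrite traj_outputs /=; case: ifPn => [big_y _|_ wrong].
    rewrite -[leLHS]add0r lerD// (bigD1 k)//= -[leLHS]addr0 lerD//; last first.
      by apply: sumr_ge0 => j _; exact: expR_ge0.
    apply: tail_bound_ge1 => //; move: big_y; rewrite nth_mkseq// /output_at input_code//.
    have := cut m; have := ler_norm (nth 0 (nth [::] cs m) 0); have := ler_norm (z 0%N k).
    by lra.
  rewrite -[leLHS]addr0 lerD//; apply: stage_bound_ge1 => //.
  by apply/existsP; exists k.
rewrite /error_prob -[leRHS]/(fine (_%:E)).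
have je : (jointE v n (fun m z =>
   (if [exists k, dec S k ((traj S m z n).1.2 k) != m] then 1 else 0)%:E)
   <= (M%:R^-1 * \sum_(m < M) error_mean theta m)%:E)%E.
  by rewrite -(jointE_mean mean); apply: le_jointE => m z //; rewrite lee_fin; case: ifP.
apply: fine_le => //; rewrite ge0_fin_numE.
  by apply: le_lt_trans je _; exact: ltry.
by apply: jointE_ge0 => m z; rewrite lee_fin; case: ifP.
Qed.

Lemma error_prob_gt0 : (0 < K)%N -> (1 < M)%N -> 0 < error_prob v n S.
Proof.
move=> K0 M1; have nn0 : (0 < n)%N by rewrite addn_gt0 n10.
pose k0 := Ordinal K0.
have [m1 m10] : exists m1 : 'I_M, m1 != m0.
  have [/eqP m00|] := eqVneq (m0 : nat) 0%N; last first.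
    by move=> m00; exists (Ordinal M0); rewrite -val_eqE/= eq_sym.
  by exists (Ordinal M1); rewrite -val_eqE/= (eqP m00).
(* When [m1] is sent, first noise above [a] lifts the first output of [k0] over the cutoff, and [k0]
   then decodes [m0], which is wrong. *)
pose a := cutoff + `|nth 0 (nth [::] cs m1) 0|.
have [e e0 ae] : exists2 e : R, 0 < e &
   (\int[normal_prob 0 (Num.sqrt (v k0))]_x (\1_(`]a, +oo[%classic) x : R)%:E = e%:E)%E.
  by apply: normal_tail_gt0; rewrite sqrtr_gt0.
have mean m : noise_mean v n
    (fun z => (m == m1)%:R * \1_(`]a, +oo[%classic) (z 0%N k0)) ((m == m1)%:R * e).
  apply: noise_meanZ => //.
  by apply: (@noise_mean_coord _ _ v n 0 k0 (\1_(`]a, +oo[%classic))).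
set J := jointE v n (fun m z =>
   (if [exists k, dec S k ((traj S m z n).1.2 k) != m] then 1 else 0)%:E).
have J1 : (J <= 1)%E.
  rewrite -(jointE1 v n M0); apply: le_jointE => m z; rewrite lee_fin; by case: ifP.
have eJ : ((M%:R^-1 * e)%:E <= J)%E.
  have -> : e = \sum_(m < M) (m == m1)%:R * e.
    rewrite (bigD1 m1)//= eqxx mul1r big1 ?addr0// => m /negbTE ->.
    by rewrite mul0r.
  rewrite -(jointE_mean mean); apply: le_jointE => m z.
    by rewrite lee_fin mulr_ge0.
  rewrite lee_fin; have [->|_] := eqVneq m m1; last by rewrite mul0r; case: ifP.
  rewrite mul1r indicE mem_setE/= in_itv/= andbT.
  case: ltP => // az; last by case: ifP.
  rewrite ifT//; apply/existsP; exists k0; rewrite traj_outputs /= nth_mkseq//.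
  rewrite /output_at input_code// ifT; first by rewrite eq_sym.
  by move: az; rewrite /a; have := ler_norm (- nth 0 (nth [::] cs m1) 0); rewrite normrN; lra.
have Me0 : 0 < M%:R^-1 * e by rewrite mulr_gt0// invr_gt0 ltr0n.
have Jfin : J \is a fin_num.
  rewrite ge0_fin_numE; first by apply: le_lt_trans J1 _; exact: ltry.
  by apply: le_trans eJ; rewrite lee_fin ltW.
by rewrite /error_prob -/J (lt_le_trans Me0)// -lee_fin fineK.
Qed.

End scheme_performance.

(** * Choice of the parameters *)

Section elementary.
Context {R : realType}.
Implicit Types x y : R.

Lemma expR_ge_double x : 0 <= x -> 2 * x <= expR x.
Proof.
move=> x0; have h : 1 + x / 2 <= expR (x / 2) by exact: expR_ge1Dx.
have -> : expR x = expR (x / 2) ^+ 2 by rewrite expr2 -expRD -splitr.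
have : (1 + x / 2) ^+ 2 <= expR (x / 2) ^+ 2.
  by rewrite lerXn2r ?nnegrE ?expR_ge0// addr_ge0// divr_ge0.
by have := sqr_ge0 (1 - x / 2); nra.
Qed.

(** Compare with the exact tower [w] started at [u 0 / 4]. The margin [4 * w i <= u i] survives the
    halved exponents: exp(u_i / 2) is at least the square of w_{i+1}, and w_{i+1} >= 4. The 12 makes
    [w] at least 3; the [- 1] absorbs a factor 2 in the error probability. *)
Lemma iter_ln_tower (u : nat -> R) l x :
  (forall i, (i < l)%N -> expR (u i / 2) <= u i.+1) -> 12 <= u 0 ->
  u l - 1 <= x -> u 0 / 4 <= iter l (@ln R) x.
Proof.
move=> uS u0 ulx; pose w i := iter i (@expR R) (u 0 / 4).
have w3 i : 3 <= w i.
  elim: i => [|i ih] /=; first by rewrite /w /=; lra.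
  by apply: (le_trans ih); have := expR_ge1Dx (w i); rewrite -/(w i) /w /= => h; lra.
have uw i : (i <= l)%N -> 4 * w i <= u i.
  elim: i => [_|i ih il]; first by rewrite /w /=; lra.
  have {ih} ui := ih (ltnW il); apply: le_trans (uS i il).
  have : expR (w i) ^+ 2 <= expR (u i / 2) by rewrite -expRM_natl ler_expR; lra.
  apply: le_trans; rewrite -[w i.+1]/(expR (w i)) expr2 ler_wpM2r ?expR_ge0//.
  by have := expR_ge1Dx (w i); have := w3 i; lra.
have wx : w l <= x by have := uw l (leqnn l); have := w3 l; lra.
suff ln_iter i y : w i <= y -> u 0 / 4 <= iter i (@ln R) y by exact: ln_iter wx.
elim: i y => // i ih y wy; rewrite iterSr; apply: ih.
by rewrite -[w i]expRK ler_ln ?posrE ?expR_gt0// (lt_le_trans _ wy)// expR_gt0.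
Qed.

(** Of the four factors E = exp(x / 4) in exp(x), one pays for [b], one for the constants, and two
    remain. Here [b] stands for [B ^ 2], the cost of the digits. *)
Lemma exp_step (ka kb b x0 x : R) : 0 < ka -> 0 < b -> 0 <= x0 -> x0 <= x ->
  16 * (1 + `|kb|) / ka <= x -> b <= 4 * expR (x0 / 4) ->
  expR (x / 2) <= ka * expR x / b - kb.
Proof.
move=> ka0 b0 x00 x0x large ble; have x_ge0 : 0 <= x by exact: le_trans x0x.
set a := `|kb| in large; have a0 : 0 <= a by exact: normr_ge0.
have kba : kb <= a by exact: ler_norm.
set E := expR (x / 4); have E0 : 0 < E := expR_gt0 _.
have Ex : x / 4 <= E by have := expR_ge1Dx (x / 4); rewrite -/E; lra.
have E1 : 1 <= E by have := expR_ge1Dx (x / 4); rewrite -/E; lra.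
have -> : expR (x / 2) = E ^+ 2.
  by rewrite -expRM_natl; congr expR; lra.
have -> : expR x = E ^+ 4.
  by rewrite -expRM_natl; congr expR; lra.
have bE : b <= 4 * E by apply: (le_trans ble); rewrite ler_wpM2l// ler_expR; lra.
have kE : 4 * (1 + a) <= ka * E.
  move: large; rewrite ler_pdivrMr// => large.
  have : x / 4 * ka <= E * ka by rewrite ler_wpM2r// ltW.
  by rewrite mulrC; lra.
have : (1 + a) * E ^+ 2 <= ka * E ^+ 4 / b.
  rewrite ler_pdivlMr//.
  apply: (@le_trans _ _ ((1 + a) * E ^+ 2 * (4 * E))).
    by rewrite ler_wpM2l// mulr_ge0 ?sqr_ge0// addr_ge0.
  have -> : (1 + a) * E ^+ 2 * (4 * E) = 4 * (1 + a) * E ^+ 3 by ring.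
  have -> : ka * E ^+ 4 = ka * E * E ^+ 3 by ring.
  by rewrite ler_wpM2r// exprn_ge0// ltW.
have : a <= a * E ^+ 2.
  by rewrite ler_peMr// exprn_ege1.
by lra.
Qed.

Lemma limn_einf_ge_eventually (u : nat -> \bar R) (l : \bar R) N :
  (forall n, (N <= n)%N -> (l <= u n)%E) -> (l <= limn_einf u)%E.
Proof.
move=> lu; rewrite limn_einf_lim; apply: lime_ge; first exact: is_cvg_einfs.
exists N => // n /= Nn; apply: le_ereal_inf_tmp => _ [k /= nk <-].
by apply: lu; exact: leq_trans nk.
Qed.

End elementary.

(** Fills the finitely many short blocklengths, where the constraints must hold but the error does
    not matter. *)
Lemma exists_silent_scheme {R : realType} (K Mn n : nat) (sig2 : 'I_K -> R) (P Rfb : R) :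
  (0 < Mn)%N -> 0 <= P -> 0 <= Rfb ->
  exists S : fb_scheme R K Mn,
    [/\ scheme_measurable n S, power_ok sig2 n S P & feedback_rate_ok sig2 n S Rfb].
Proof.
move=> M0 P0 Rfb0; pose S : fb_scheme R K Mn :=
  FbScheme (fun _ _ _ => 0) (fun _ _ _ => 0%N) (fun _ _ => Ordinal M0).
exists S; split.
- split=> [k i c _|k m]; [exact: (discrete_measurable_cst 0%N c)|].
  exact: (discrete_measurable_cst (Ordinal M0) m).
- rewrite /power_ok (_ : (fun _ => _) = fun=> fun=> 0%:E).
    rewrite (@jointE_mean _ _ _ _ _ (fun=> fun=> 0) (fun=> 0)).
      by rewrite big1// mulr0 lee_fin mulr_ge0.
    by move=> m; exact: noise_mean_cst.
  apply/funext => m; apply/funext => z; rewrite traj_inputs big_map big1//.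
  by move=> i _; rewrite /input_at /= expr0n.
- move=> k; rewrite big1 ?lee_fin ?mulr_ge0// => i _.
  rewrite (_ : fb_pmf _ _ _ _ _ =
    discrete_law sig2 n (fun m z => nth 0%N ((traj S m z n).2 k) i))//.
  by apply: (@entropy_discrete_law_const _ _ _ _ _ M0 _ 0%N) => m z; rewrite traj_feedback nth_mkseq.
Qed.

(** * The scheme at a fixed blocklength *)

Section fixed_blocklength.
Context {R : realType} {K M : nat}.
Variables (v : 'I_K -> R) (p thr P1 P Rfb w delta s eps0 : R) (cs : seq (seq R)).
Variables (n1 d Lp B : nat).
Hypotheses (K0 : (0 < K)%N) (n10 : (0 < n1)%N) (d0 : (0 < d)%N) (B0 : (0 < B)%N).
Hypotheses (szcs : size cs = M) (MB : (M <= B ^ d)%N) (M1 : (1 < M)%N).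
Hypotheses (Me : expR 1 <= M%:R :> R).
Hypotheses (p0 : 0 < p) (v0 : forall k, 0 < v k) (vw : forall k, v k <= w).
Hypotheses (s0 : 0 <= s) (s1 : s <= 1) (eps00 : 0 < eps0) (delta0 : 0 < delta).
Hypothesis code_power : forall c, c \in cs -> \sum_(t < n1) nth 0 c t ^+ 2 <= n1%:R * P1.
Hypothesis code_error :
  \sum_(i < M) \sum_(k < K) awgn_err_mean p (v k) s thr n1 cs i <= M%:R * eps0.
Hypothesis budget : n1%:R * P1 + Lp%:R * (d%:R * delta) <= (n1 + Lp * d)%:R * P.
Hypothesis fb_budget : Lp%:R * ln M%:R <= (n1 + Lp * d)%:R * Rfb.

(** Upper bound on the probability that some guess after stage [l] is wrong, when
    the amplitudes spend energy [d * delta] on average in every resending phase. *)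
Fixpoint stage_eps (l : nat) : R :=
  if l is l'.+1 then
    K%:R * (d%:R * (Num.sqrt 2 *
      expR (- (delta / (stage_eps l' * B%:R ^+ 2) / (16 * w)))))
  else eps0.

Let w0 : 0 < w. Proof. exact: lt_le_trans (v0 (Ordinal K0)) (vw _). Qed.
Let MR0 : 0 < M%:R :> R. Proof. by rewrite ltr0n ltnW. Qed.

Lemma stage_eps_gt0 l : 0 < stage_eps l.
Proof.
case: l => //= l; do 3 (apply: mulr_gt0; first by rewrite ?ltr0n ?sqrtr_gt0).
exact: expR_gt0.
Qed.

Definition stage_amplitude l := Num.sqrt (delta / (stage_eps l * B%:R ^+ 2)).

Let amp_arg0 l : 0 < delta / (stage_eps l * B%:R ^+ 2).
Proof. by rewrite divr_gt0// mulr_gt0 ?stage_eps_gt0// exprn_gt0// ltr0n. Qed.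

Lemma stage_amplitude_gt0 l : 0 < stage_amplitude l.
Proof. by rewrite sqrtr_gt0. Qed.

Let amp2 l : stage_amplitude l ^+ 2 = delta / (stage_eps l * B%:R ^+ 2).
Proof. by rewrite sqr_sqrtr// ltW. Qed.

Lemma tail_le_worst k x : 0 <= x -> expR (- (x / v k)) <= expR (- (x / w)).
Proof. by move=> x0; rewrite ler_expR lerN2 ler_wpM2l// lef_pV2 ?posrE. Qed.

Lemma mean_stage_le l :
  M%:R^-1 * \sum_(m < M) stage_mean v p thr cs n1 d stage_amplitude s l m <= stage_eps l.
Proof.
rewrite ler_pdivrMl//; case: l => [|l]; first exact: code_error.
have -> : M%:R * stage_eps l.+1 = \sum_(m < M) stage_eps l.+1.
  by rewrite sumr_const card_ord -[RHS]mulr_natl.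
apply: ler_sum => m _ /=.
set E := Num.sqrt 2 * _.
have -> : K%:R * (d%:R * E) = \sum_(k < K) \sum_(j < d) E.
  by rewrite !sumr_const !card_ord -[E *+ d]mulr_natl -[RHS]mulr_natl.
apply: ler_sum => k _; apply: ler_sum => j _.
rewrite /E ler_wpM2l// expr_div_n amp2.
set y := delta / _; have y0 : 0 < y := amp_arg0 l.
have -> : y / 2 ^+ 2 / (4 * v k) = y / 16 / v k by field; rewrite gt_eqF.
have -> : y / (16 * w) = y / 16 / w by field; rewrite gt_eqF.
by apply: tail_le_worst; rewrite divr_ge0// ltW.
Qed.

Lemma exists_resend_scheme : exists S : fb_scheme R K M,
  [/\ scheme_measurable (n1 + Lp * d) S, power_ok v (n1 + Lp * d) S P,
      feedback_rate_ok v (n1 + Lp * d) S Rfb,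
      0 < error_prob v (n1 + Lp * d) S &
      error_prob v (n1 + Lp * d) S <= 2 * stage_eps Lp].
Proof.
have M0 : (0 < M)%N := ltnW M1.
(* With [theta ^+ 2 = 4 * w * X] and exp(-X) <= 1 / X, the cutoff adds at most another
   [stage_eps Lp] to the error. *)
pose X := K%:R * Num.sqrt 2 / stage_eps Lp.
have KR0 : 0 < K%:R :> R by rewrite ltr0n.
have X0 : 0 < X by rewrite divr_gt0 ?stage_eps_gt0// mulr_gt0// sqrtr_gt0.
pose theta := Num.sqrt (4 * w * X).
have q0 : 0 < 4 * w * X by do 2 apply: mulr_gt0 => //.
have th2 : theta ^+ 2 = 4 * w * X by rewrite sqr_sqrtr// ltW.
pose cutoff := \sum_(m < M) `|nth 0 (nth [::] cs m) 0| + theta.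
have cut (m : 'I_M) : `|nth 0 (nth [::] cs m) 0| + theta <= cutoff.
  by rewrite lerD2r (bigD1 m)//= lerDl sumr_ge0.
have th0 : 0 <= theta by exact: sqrtr_ge0.
exists (resend_scheme v p thr cs n1 d Lp B stage_amplitude cutoff (Ordinal M0)); split.
- exact: resend_scheme_measurable.
- apply: (@power_ok_resend _ _ _ _ _ _ _ _ _ _ _ _ _ _ n10 d0 B0 szcs MB stage_amplitude_gt0 p0 v0 s s0 s1 P1).
    by move=> m; apply: code_power; rewrite mem_nth// szcs.
  apply: le_trans budget; rewrite lerD2l.
  have -> : Lp%:R * (d%:R * delta) = \sum_(l < Lp) d%:R * delta.
    by rewrite sumr_const card_ord -[RHS]mulr_natl.
  apply: ler_sum => l _; rewrite -mulrA ler_wpM2l// exprMn amp2.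
  apply: (@le_trans _ _ (delta / (stage_eps l * B%:R ^+ 2) * B%:R ^+ 2 * stage_eps l)).
    by rewrite ler_wpM2l ?mean_stage_le// mulr_ge0 ?sqr_ge0// ltW.
  rewrite le_eqVlt; apply/orP; left; apply/eqP; field.
  by rewrite pnatr_eq0 -lt0n B0 gt_eqF// stage_eps_gt0.
- exact: feedback_rate_ok_resend.
- exact: error_prob_gt0.
apply: (le_trans (error_prob_le thr Lp (Ordinal M0) n10 d0 szcs MB stage_amplitude_gt0 p0 v0 s0 s1 th0 cut)).
rewrite big_split/= mulrDr mulrDl mul1r lerD ?mean_stage_le//.
rewrite sumr_const card_ord; set F := \sum_(k < K) _.
rewrite -[F *+ M]mulr_natl mulKf ?gt_eqF// /F.
apply: (@le_trans _ _ (\sum_(k < K) Num.sqrt 2 * X^-1)).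
  apply: ler_sum => k _; rewrite ler_wpM2l//.
  apply: (@le_trans _ _ (expR (- X))).
    rewrite th2 ler_expR lerN2 ler_pdivlMr ?mulr_gt0//.
    rewrite mulrC (_ : 4 * w * X = 4 * X * w); last by ring.
    by rewrite (_ : 4 * v k * X = 4 * X * v k); [rewrite ler_wpM2l// mulr_ge0// ltW|ring].
  rewrite expRN lef_pV2 ?posrE ?expR_gt0//.
  by have := expR_ge1Dx X; lra.
rewrite sumr_const card_ord -[(_ * X^-1) *+ K]mulr_natl /X.
rewrite le_eqVlt; apply/orP; left; apply/eqP; field.
by rewrite !gt_eqF// ?stage_eps_gt0// sqrtr_gt0.
Qed.

End fixed_blocklength.

Lemma exists_resend_schemes {R : realType} {K : nat} (v : 'I_K -> R)
    (P r Rfb w : R) (Lp : nat) :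
  (0 < K)%N -> 0 < P -> (forall k, 0 < v k) -> (forall k, v k <= w) ->
  0 < r -> r < 2^-1 * ln (1 + P / w) -> Lp%:R * r <= Rfb ->
  exists (N : nat) (gamma : R), 0 < gamma /\
  forall n, (N <= n)%N -> exists S : fb_scheme R K (num_msgs r n),
    [/\ scheme_measurable n S, power_ok v n S P, feedback_rate_ok v n S Rfb &
        gamma <= n%:R^-1 * iter_log Lp.+1 (error_prob v n S)].
Proof.
move=> K0 P0 v0 vw r0 rC fbR.
have w0 : 0 < w by exact: lt_le_trans (v0 (Ordinal K0)) (vw _).
(* The power at which the noisiest channel has capacity exactly [r]. *)
pose pmin := (expR (2 * r) - 1) * w.
have er1 : 1 < expR (2 * r) by rewrite expR_gt1 mulr_gt0.
have pmin0 : 0 < pmin by rewrite mulr_gt0// subr_gt0.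
have capE x : 0 < x -> pmin < x -> r < 2^-1 * ln (1 + x / w).
  move=> x0 px; have : expR (2 * r) < 1 + x / w.
    by rewrite -ltrBlDl ltr_pdivlMr.
  have xw0 : 0 < 1 + x / w by rewrite addr_gt0// divr_gt0.
  by rewrite -ltr_ln ?posrE ?expR_gt0// expRK; lra.
have pminP : pmin < P.
  rewrite -ltr_pdivlMr// ltrBlDl -ltr_ln ?posrE ?expR_gt0 ?addr_gt0 ?divr_gt0//.
  by rewrite expRK; lra.
have [p [P1 [pminp pP1 P1P]]] : exists p P1, [/\ pmin < p, p < P1 & P1 < P].
  by exists ((2 * pmin + P) / 3), ((pmin + 2 * P) / 3); split; lra.
have p0 : 0 < p by exact: lt_trans pminp.
(* The gap above [r] beats the number of competing words, the gap below [Cmin] lets the sent word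
   pass. *)
pose Cmin := awgn_capacity p w; pose thr := (r + Cmin) / 2.
have rCmin : r < Cmin by exact: capE.
have thrC : thr < Cmin by rewrite /thr; lra.
have rthr : r < thr by rewrite /thr; lra.
have capmin k : Cmin <= awgn_capacity p (v k).
  rewrite /Cmin /awgn_capacity ler_wpM2l// ler_ln ?posrE ?addr_gt0 ?divr_gt0//.
  by rewrite lerD2l ler_wpM2l ?(ltW p0)// lef_pV2 ?posrE.
have [s [T [c [/andP[s0 s1] T0 c0 codes]]]] := awgn_codebooks K0 p0 pP1 v0 thrC capmin.
pose c' := Num.min c (thr - r).
have c'0 : 0 < c' by rewrite lt_min c0 subr_gt0.
have c'c : c' <= c by rewrite ge_min lexx.
have c't : c' <= thr - r by rewrite ge_min lexx orbT.
(* Gives B^2 <= 4 exp(2nr/d) <= 4 exp(c'n/8) <= 4 exp(u_0/4), as [exp_step] requires. *)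
pose d := (Num.truncn (16 * r / c')).+1.
have d0 : 0 < d%:R :> R by rewrite ltr0n.
have dr : 2 * r / d%:R <= c' / 8.
  have : 16 * r / c' < d%:R by exact: truncnS_gt.
  by rewrite ltr_pdivrMr// => h; rewrite ler_pdivrMr//; lra.
pose D := (Lp * d)%N.
(* Absorbs the loss from coding over [n - D] instead of [n] channel uses. *)
pose A := T * (expR (D%:R * c) + expR (D%:R * thr)).
have A0 : 0 < A by rewrite mulr_gt0// addr_gt0// expR_gt0.
(* Total resending energy is then at most [P - P1]; the successor avoids dividing by zero when there
   is no resending phase. *)
pose delta := (P - P1) / (Lp.+1%:R * d%:R).
have delta0 : 0 < delta by rewrite divr_gt0 ?subr_gt0// mulr_gt0// ltr0n.
(* The constants in the recursion u_{l+1} = ka exp(u_l) / B^2 - kb for u_l = -ln(eps_l). *)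
pose ka := delta / (16 * w); pose kb := ln (K%:R * (d%:R * Num.sqrt (2 : R))).
have ka0 : 0 < ka by rewrite divr_gt0// mulr_gt0.
pose U := 12 + 16 * (1 + `|kb|) / ka.
have kbka : 0 <= 16 * (1 + `|kb|) / ka.
  by rewrite divr_ge0 ?(ltW ka0)// mulr_ge0// addr_ge0.
(* The summands ensure in turn a nonempty code phase, at least e messages, [u 0 >= c' * n / 2], and
   [u 0 >= U]. *)
pose bigN := D.+1%:R + 2 / r + 2 * `|ln A| / c' + 2 * U / c'.
(* [u 0] is at least c'n/2 and [iter_ln_tower] keeps a quarter of it. *)
exists (Num.truncn bigN).+1, (c' / 8); split; first by rewrite divr_gt0.
move=> n Nn.
have nbig : bigN < n%:R.
  by apply: lt_le_trans (truncnS_gt _) _; rewrite ler_nat.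
have [n2r nA nU nD] : [/\ 2 / r <= n%:R, 2 * `|ln A| / c' <= n%:R,
    2 * U / c' <= n%:R & D.+1%:R <= n%:R :> R].
  have q1 : 0 <= 2 / r by rewrite divr_ge0// ltW.
  have q2 : 0 <= 2 * `|ln A| / c' by rewrite divr_ge0 ?(ltW c'0)// mulr_ge0.
  have q3 : 0 <= 2 * U / c' by rewrite divr_ge0 ?(ltW c'0)// mulr_ge0// addr_ge0.
  have q4 : 0 <= D.+1%:R :> R by [].
  by move: nbig; rewrite /bigN; split; lra.
rewrite ler_nat in nD; rewrite ler_pdivrMr// in n2r.
rewrite ler_pdivrMr// in nA; rewrite ler_pdivrMr// in nU.
pose n1 := (n - D)%N.
have n10 : (0 < n1)%N by rewrite subn_gt0.
have nE : n = (n1 + Lp * d)%N by rewrite subnK// ltnW.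
have n0 : 0 < n%:R :> R by rewrite ltr0n; exact: leq_ltn_trans (leq0n _) nD.
have n1E : n1%:R = n%:R - D%:R :> R by rewrite natrB// ltnW.
set M := num_msgs r n.
have Mle : M%:R <= expR (n%:R * r) by rewrite truncn_le expR_ge0.
have Mgt : expR (n%:R * r) < M%:R + 1 by rewrite natr1 truncnS_gt.
have e2 : 2 <= expR 1 :> R by have := expR_ge1Dx (1 : R); lra.
have Me : expR 1 <= M%:R :> R.
  have : expR 2 <= expR (n%:R * r) by rewrite ler_expR.
  have -> : expR 2 = expR 1 ^+ 2 :> R by rewrite -expRM_natl mulr1.
  by nra.
have M1 : (1 < M)%N by rewrite -(ltr_nat R); lra.
have MR0 : 0 < M%:R :> R by rewrite ltr0n ltnW.
pose b := expR (n%:R * r / d%:R).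
have b1 : 1 <= b by rewrite -[leLHS]expR0 ler_expR divr_ge0 ?mulr_ge0// ltW.
pose B := (Num.truncn b).+1.
have Bgt : b < B%:R by exact: truncnS_gt.
have Ble : B%:R <= 2 * b.
  have : (Num.truncn b)%:R <= b by rewrite truncn_le; lra.
  by rewrite /B -natr1; lra.
have MB : (M <= B ^ d)%N.
  rewrite -(ler_nat R) natrX; apply: (le_trans Mle).
  apply: (@le_trans _ _ (b ^+ d)); last by rewrite lerXn2r ?nnegrE// ltW// expR_gt0.
  by rewrite -expRM_natl [d%:R * _]mulrC divfK// gt_eqF.
have [cs [szcs csP cserr]] := codes n1 M n10.
pose eps0 := A * expR (- (c' * n%:R)).
have eps00 : 0 < eps0 by rewrite mulr_gt0 ?expR_gt0.
have code_error : \sum_(i < M) \sum_(k < K) awgn_err_mean p (v k) s thr n1 cs i <= M%:R * eps0.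
  apply: (le_trans cserr); rewrite ler_wpM2l// /eps0 /A -mulrA ler_wpM2l ?(ltW T0)//.
  rewrite mulrDl -!expRD n1E; apply: lerD.
    by rewrite ler_expR; nra.
  apply: (@le_trans _ _ (expR (n%:R * r) * expR (- ((n%:R - D%:R) * thr)))).
    by rewrite ler_wpM2r// expR_ge0.
  by rewrite -expRD ler_expR; nra.
have budget : n1%:R * P1 + Lp%:R * (d%:R * delta) <= (n1 + Lp * d)%:R * P.
  rewrite -nE; apply: (@le_trans _ _ (n%:R * P1 + (P - P1))).
    apply: lerD; first by rewrite ler_wpM2r ?ler_nat ?leq_subr//; lra.
    have -> : Lp%:R * (d%:R * delta) = (P - P1) * (Lp%:R / Lp.+1%:R).
      by rewrite /delta; field; rewrite pnatr_eq0 gt_eqF//.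
    by rewrite ler_piMr ?subr_ge0 ?(ltW P1P)// ler_pdivrMr ?ltr0n// mul1r ler_nat.
  have n1' : 1 <= n%:R :> R by rewrite ler1n -(ltr0n R).
  by nra.
have fb_budget : Lp%:R * ln M%:R <= (n1 + Lp * d)%:R * Rfb.
  rewrite -nE; apply: (@le_trans _ _ (Lp%:R * (n%:R * r))).
    by rewrite ler_wpM2l// -[leRHS]expRK ler_ln ?posrE ?expR_gt0.
  by rewrite mulrCA ler_wpM2l.
have B0 : (0 < B)%N by [].
have [S [S1 S2 S3 S4 S5]] := exists_resend_scheme K0 n10 (ltn0Sn _ : (0 < d)%N) B0 szcs MB M1 Me
  p0 v0 vw s0 s1 eps00 delta0 (fun x xcs => (csP x xcs).2) code_error budget fb_budget.
exists S; rewrite -nE in S1 S2 S3 S4 S5; split => //.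
pose eps := @stage_eps R K w delta eps0 d B.
have eps_gt0 l : 0 < eps l by apply: stage_eps_gt0.
pose u l := - ln (eps l).
have epsV l : (eps l)^-1 = expR (u l) by rewrite expRN lnK ?posrE.
have u0E : u 0 = c' * n%:R - ln A.
  by rewrite /u /eps/= lnM ?posrE ?expR_gt0// expRK; lra.
have lnA : ln A <= `|ln A| by exact: ler_norm.
have u0half : c' * n%:R / 2 <= u 0 by rewrite u0E; lra.
have u0U : U <= u 0 by lra.
have BR0 : 0 < B%:R ^+ 2 :> R by rewrite exprn_gt0// ltr0n.
have Bu0 : B%:R ^+ 2 <= 4 * expR (u 0 / 4).
  apply: (@le_trans _ _ ((2 * b) ^+ 2)).
    by rewrite lerXn2r ?nnegrE ?mulr_ge0// ?expR_ge0.
  rewrite exprMn (_ : 2 ^+ 2 = 4 :> R); last by ring.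
  rewrite ler_wpM2l// -expRM_natl ler_expR.
  have : n%:R * (2 * r / d%:R) <= n%:R * (c' / 8) by rewrite ler_wpM2l// ltW.
  by move: u0half; lra.
have uS l : u 0 <= u l -> expR (u l / 2) <= u l.+1.
  move=> u0l.
  have -> : u l.+1 = ka * expR (u l) / B%:R ^+ 2 - kb.
    rewrite {1}/u /eps /= -/(eps l) !mulrA lnM ?posrE ?expR_gt0//; last first.
      by rewrite !mulr_gt0 ?sqrtr_gt0// ltr0n.
    rewrite expRK /kb mulrA opprD opprK addrC; congr (_ - _).
    by rewrite -epsV /ka; field; rewrite !gt_eqF.
  apply: (exp_step ka0 BR0 _ u0l _ Bu0); first by move: u0U; rewrite /U; lra.
  by move: u0U; rewrite /U; lra.
have u0l l : u 0 <= u l.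
  elim: l => // l ih; apply: le_trans (uS l ih); apply: (le_trans ih).
  have ul0 : 0 <= u l by move: u0U; rewrite /U; lra.
  by have := @expR_ge_double R (u l / 2); rewrite divr_ge0// => /(_ isT); lra.
have lnpe : u Lp - 1 <= - ln (error_prob v n S).
  have : ln (error_prob v n S) <= ln (2 * eps Lp) by rewrite ler_ln ?posrE ?mulr_gt0.
  rewrite lnM ?posrE// /u.
  by have := @le_ln1Dx R 1; rewrite (_ : 1 + 1 = 2 :> R)//; lra.
have tower : u 0 / 4 <= iter_log Lp.+1 (error_prob v n S).
  by apply: iter_ln_tower lnpe => [i _|]; [exact: uS|move: u0U; rewrite /U; lra].
by rewrite ler_pdivlMl//; lra.
Qed.

Theorem theorem2 (R : realType) (K : nat) (sig2 : 'I_K -> R) (P : R)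
  (C rate Rfb : R) (L : nat) :
  (2 <= K)%N -> 0 < P ->
  (forall k : 'I_K, 0 < sig2 k) ->
  (forall k l : 'I_K, (k <= l)%N -> sig2 l <= sig2 k) ->
  forall hK : (0 < K)%N,
  C = 2^-1 * ln (1 + P / sig2 (Ordinal hK)) ->
  0 < rate -> rate < C -> (0 < L)%N ->
  (L.-1)%:R * rate <= Rfb ->
  Lth_order_achievable sig2 P Rfb rate L.
Proof.
move=> _ P0 sig20 sig2_noninc hK -> rate0 rateC L0 fbR.
(* The first receiver is the noisiest, so [C] is the smallest of the single-receiver capacities. *)
have worst k : sig2 k <= sig2 (Ordinal hK) by exact: sig2_noninc.
have [N [gamma [gamma0 good]]] :=
  exists_resend_schemes hK P0 sig20 worst rate0 rateC fbR.
rewrite prednK// in good.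
have msgs0 n : (0 < num_msgs rate n)%N.
  by rewrite truncn_gt0 -[leLHS]expR0 ler_expR mulr_ge0// ltW.
have Rfb0 : 0 <= Rfb by apply: le_trans fbR; rewrite mulr_ge0// ltW.
have allN n : exists S : fb_scheme R K (num_msgs rate n),
    [/\ scheme_measurable n S, power_ok sig2 n S P, feedback_rate_ok sig2 n S Rfb &
        (N <= n)%N -> gamma <= n%:R^-1 * iter_log L (error_prob sig2 n S)].
  have [Nn|nN] := leqP N n; first by have [S [? ? ? ?]] := good n Nn; exists S.
  have [S [? ? ?]] := exists_silent_scheme n sig2 (msgs0 n) (ltW P0) Rfb0.
  by exists S; split => //; rewrite leqNgt nN.
exists (fun n => projT1 (cid (allN n))); split.
  by move=> n; have [? ? ? _] := projT2 (cid (allN n)).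
apply: (@lt_le_trans _ _ gamma%:E); first by rewrite lte_fin.
apply: (@limn_einf_ge_eventually _ _ _ N) => n Nn; rewrite lee_fin.
by have [_ _ _] := projT2 (cid (allN n)); exact.
Qed.
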